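(* The pointwise topology is the unique second countable metrisable Baire semigroup topology on $\mathcal{M}_{\mathbb{Q}}$. That is, the pointwise topology $\mathcal{T}_{pw}$ is a second countable metrisable Baire semigroup topology on $\mathcal{M}_{\mathbb{Q}}$, and every second countable metrisable semigroup topology $\mathcal{T}$ on $\mathcal{M}_{\mathbb{Q}}$ for which $(\mathcal{M}_{\mathbb{Q}},\mathcal{T})$ is a Baire space satisfies $\mathcal{T}=\mathcal{T}_{pw}$.
   Context: $\mathcal{M}_{\mathbb{Q}}$ is the monoid, under composition of functions, of all (not necessarily strictly) increasing maps $f\colon\mathbb{Q}\to\mathbb{Q}$ with respect to the usual order. The pointwise topology $\mathcal{T}_{pw}$ on $\mathcal{M}_{\mathbb{Q}}$ is the subspace topology inherited from the product topology on $\mathbb{Q}^{\mathbb{Q}}$, where each copy of $\mathbb{Q}$ is discrete; it is generated by the sets $\{s\in\mathcal{M}_{\mathbb{Q}} : s(x)=y\}$, $x,y\in\mathbb{Q}$. A topology on $\mathcal{M}_{\mathbb{Q}}$ is a semigroup topology if composition $\mathcal{M}_{\mathbb{Q}}\times\mathcal{M}_{\mathbb{Q}}\to\mathcal{M}_{\mathbb{Q}}$ is continuous. A Baire space is a topological space in which every countable intersection of dense open sets is dense. *)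

(* Defs.v *)
From HB Require Import structures.
From mathcomp Require Import all_boot all_order all_algebra.
From mathcomp Require Import all_classical all_reals all_analysis.

Set Implicit Arguments.
Unset Strict Implicit.
Unset Printing Implicit Defensive.

Import Order.TTheory GRing.Theory Num.Theory.

Local Open Scope classical_set_scope.
Local Open Scope ring_scope.

(* A topology on a type S is a value of the library's class [Topological S],
   so that topologies on a fixed carrier can be quantified over and compared;
   the topologies carried by S canonically play no role. *)
Definition top_space (S : Type) (tau : Topological S) : topologicalType :=
  Topological.Pack tau.

(* A topology is determined by its open sets; the class also contains a choice
   structure on S, so topologies are compared through this family. *)
Definition opens (S : Type) (tau : Topological S) : set (set S) :=
  @open (top_space tau).

Definition metrisable (R : realType) (T : topologicalType) : Prop :=
  exists m : Metric R T, @open (Metric.Pack m) = @open T.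

Definition baire_space (T : topologicalType) : Prop :=
  forall U : nat -> set T,
    (forall n, open (U n) /\ dense (U n)) -> dense (\bigcap_n U n).

Definition semigroup_topology (S : Type) (op : S -> S -> S)
    (tau : Topological S) : Prop :=
  continuous
    (fun p : top_space tau * top_space tau => op p.1 p.2 : top_space tau).

Definition MQ : Type := set_type [set f : rat -> rat | {homo f : x y / x <= y}].

HB.instance Definition _ := Choice.on MQ.

Lemma MQ_homo (f : MQ) : {homo val f : x y / x <= y}.
Proof. exact: set_mem (valP f). Qed.

Lemma MQ_comp_subproof (f g : MQ) :
  val f \o val g \in [set h : rat -> rat | {homo h : x y / x <= y}].
Proof. by apply/mem_set => x y /= /(MQ_homo g) /(MQ_homo f). Qed.

Definition MQ_comp (f g : MQ) : MQ :=
  exist _ (val f \o val g) (MQ_comp_subproof f g).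

Definition MQ_incl (f : MQ) : {ptws rat -> discrete_topology rat} := val f.

Definition pointwise_topology : Topological MQ :=
  Topological.class (initial_topology MQ_incl).

Definition sc_metrisable_baire_semigroup_topology (R : realType)
    (tau : Topological MQ) : Prop :=
  [/\ @second_countable (top_space tau), metrisable R (top_space tau),
      baire_space (top_space tau) & semigroup_topology MQ_comp tau].

(* Main.v *)
Require Import Defs.
From mathcomp Require Import all_boot all_order all_algebra.
From mathcomp Require Import all_classical all_reals all_analysis.
From HB Require Import structures.
From mathcomp Require Import ring lra zify.

Set Implicit Arguments.
Unset Strict Implicit.
Unset Printing Implicit Defensive.

Import Order.TTheory GRing.Theory Num.Theory.

Local Open Scope classical_set_scope.
Local Open Scope ring_scope.

(** The pointwise topology has the stated properties for elementary reasons: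
    the cylinders of maps with prescribed values on a finite set form a
    countable base, the index of the first difference gives an ultrametric, and
    pointwise limits of increasing maps are increasing. The content is
    uniqueness. Let tau be another such topology; only the properties of a
    countable base collected in [semigroup_base] are used.

    The topology tau is finer than the pointwise one already because points are
    closed: composing g on the left with a two-valued step and on the right with
    a constant turns the inequalities between g x and a given value into open
    conditions ([eval_open]).

    For the converse call a map generic if it is surjective and its fibres have
    no endpoints. Generic maps are tau-dense: if a neighbourhood of s consisted
    of maps with a gap, then s would factor through uncountably many different
    gaps, and second countability would allow factors belonging to two
    different gaps to be composed, which fills the gap ([move_into_gap]); the
    Baire property does the rest ([generic_dense]). By back and forth, two
    generic maps e and t that agree on a finite set F satisfy t = e o a for an
    automorphism a that fixes F ([generic_homogeneous]). It is therefore enough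
    to find, for a neighbourhood V of the identity, a finite F such that e is
    carried to t by boundedly many elements of V. One may assume that e and t
    also agree at arbitrarily large and at arbitrarily small points, which is a
    dense condition on t ([agree_cofinally_dense]); regularity extends the
    conclusion to all maps ([base_sub_pointwise]).

    This is a form of automatic continuity for the group of automorphisms, made
    easier by the fact that e is constant near every point: what an automorphism
    does inside a fibre of e is invisible. Countably many sets whose quotients
    lie in V cover the group. By Baire category, V realises every element of the
    stabiliser of some finite F on arbitrary finite sets
    ([cover_approximates]); by diagonalisation, among infinitely many disjoint
    pieces there is one on which V realises everything
    ([cover_matches_piece]). Neither controls an element of V globally. Near
    plus and minus infinity the uncontrolled part is removed by factoring the
    identity through uncountably many almost disjoint families of intervals
    ([match_deep_levels]), which makes e agree with t far out
    ([tail_correction]). On the remaining bounded part an element of V stretches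
    the piece on which everything is realised until the uncontrolled part fits
    into fibres of e ([compact_correction]). *)

(** * Increasing maps and automorphisms of the rational order *)

Definition MQ_fun (f : MQ) : rat -> rat := val f.
Coercion MQ_fun : MQ >-> Funclass.

Lemma MQ_le (f : MQ) : {homo f : x y / x <= y}.
Proof. exact: MQ_homo. Qed.

Lemma MQ_ext (f g : MQ) : f =1 g -> f = g.
Proof. by move=> fg; apply/val_inj/funext. Qed.

Definition MQ_of (f : rat -> rat) (fh : {homo f : x y / x <= y}) : MQ :=
  exist _ f (mem_set fh).

Lemma MQ_ltW (f : MQ) x y : f x < f y -> x < y.
Proof. by rewrite !ltNge; apply: contraNN; exact: MQ_le. Qed.

Definition MQ_id : MQ := @MQ_of id (fun x y xy => xy).

Definition MQ_cst (q : rat) : MQ := @MQ_of (fun=> q) (fun x y xy => lexx q).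

Record aut := Aut {
  fwd :> MQ;
  bwd : MQ;
  fwdK : cancel fwd bwd;
  bwdK : cancel bwd fwd }.

Definition autV (a : aut) : aut := Aut (bwdK a) (fwdK a).

Lemma autM_fwdK (a b : aut) :
  cancel (MQ_comp a b) (MQ_comp (bwd b) (bwd a)).
Proof.
move=> x; have -> : MQ_comp a b x = a (b x) by [].
by rewrite [LHS](_ : _ = bwd b (bwd a (a (b x))))// !fwdK.
Qed.

Definition autM (a b : aut) : aut :=
  Aut (@autM_fwdK a b) (@autM_fwdK (autV b) (autV a)).

Lemma autME (a b : aut) x : autM a b x = a (b x). Proof. by []. Qed.

Lemma autKV (a : aut) x : autV a (a x) = x. Proof. exact: fwdK. Qed.

Lemma autVK (a : aut) x : a (autV a x) = x. Proof. exact: bwdK. Qed.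

Definition aut1 : aut := @Aut MQ_id MQ_id (fun=> erefl) (fun=> erefl).

Lemma aut_of_bijection (a b : rat -> rat) :
  {homo a : x y / x <= y} -> cancel a b -> cancel b a ->
  exists g : aut, g =1 a.
Proof.
move=> ah aK bK.
have bh : {homo b : x y / x <= y}.
  move=> x y xy; rewrite leNgt; apply/negP => yx.
  have := ah _ _ (ltW yx); rewrite !bK => yx'.
  by move: yx; rewrite (@le_anti _ _ x y) ?ltxx// xy yx'.
have K1 : cancel (MQ_of ah) (MQ_of bh) by [].
have K2 : cancel (MQ_of bh) (MQ_of ah) by [].
by exists (Aut K1 K2).
Qed.

Lemma aut_le (a : aut) x y : (a x <= a y) = (x <= y).
Proof.
apply/idP/idP; last exact: MQ_le.
by move=> /(MQ_le (bwd a)); rewrite !fwdK.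
Qed.

Lemma aut_lt (a : aut) x y : (a x < a y) = (x < y).
Proof. by rewrite !ltNge aut_le. Qed.

Definition fixes (a : aut) (X : set rat) := forall x, X x -> a x = x.

Lemma fixesV a X : fixes a X -> fixes (autV a) X.
Proof. by move=> aX x Xx; rewrite -[LHS](congr1 (autV a) (aX x Xx)) autKV. Qed.

Lemma fixesM a b X : fixes a X -> fixes b X -> fixes (autM a b) X.
Proof. by move=> aX bX x Xx; rewrite autME bX// aX. Qed.

(** Automorphisms can be patched along any colouring of the rationals, provided
    that any two differently coloured points are separated by fixed points of
    the two patches: such points keep the order, and they also prevent a patch
    from moving a point into another colour, so the inverses patch as well. *)
Lemma glue_aut (T : Type) (c : rat -> T) (a : T -> aut) :
  (forall x y, x < y -> c x <> c y -> exists z z',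
    [/\ x < z, z <= z', z' <= y, a (c x) z = z & a (c y) z' = z']) ->
  exists g : aut, forall x, g x = a (c x) x.
Proof.
move=> sep.
have aC (b : T -> aut) : (forall k x, a k x = x <-> b k x = x) ->
    forall x, c (b (c x) x) = c x.
  move=> ab x; apply: contrapT => cx.
  have [bx|bx|bx] := ltgtP (b (c x) x) x; last by rewrite bx in cx.
  - have [z [z' [xz zz' zy _ /ab z'z]]] := sep _ _ bx cx.
    by move: zy; rewrite -(aut_le (b (c x))) z'z leNgt (lt_le_trans xz zz').
  - have [z [z' [xz zz' zy /ab zz _]]] := sep _ _ bx (nesym cx).
    by move: xz; rewrite -(aut_lt (b (c x))) zz ltNge (le_trans zz' zy).
have ah : {homo (fun x => a (c x) x) : x y / x <= y}.
  move=> x y; rewrite le_eqVlt => /predU1P[->//|xy].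
  have [->|cxy] := pselect (c x = c y); first by rewrite aut_le ltW.
  have [z [z' [xz zz' zy az az']]] := sep _ _ xy cxy.
  apply: (@le_trans _ _ z); first by rewrite -az aut_le ltW.
  by apply: le_trans zz' _; rewrite -az' aut_le.
pose b k := autV (a k).
have ab k x : a k x = x <-> b k x = x.
  by split=> e; rewrite -[LHS](congr1 _ e) (autKV, autVK).
have ac x : c (a (c x) x) = c x by exact: aC.
have bc x : c (b (c x) x) = c x by exact: aC.
by apply: (aut_of_bijection ah (b := fun x => b (c x) x)) => x;
  rewrite (ac, bc) (autKV, autVK).
Qed.

(** The form of dependent choice behind the Baire category arguments and the
    back-and-forth construction below. *)
Lemma dependent_chain (C : Type) (ok : C -> Prop) (R : nat -> C -> C -> Prop) :
  (forall n c, ok c -> exists2 c', ok c' & R n c c') ->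
  forall c0, ok c0 -> exists Q : nat -> C,
    [/\ Q 0%N = c0, forall n, ok (Q n) & forall n, R n (Q n) (Q n.+1)].
Proof.
move=> step c0 ok0.
have /choice[f fP] : forall nc : nat * {c | ok c}, exists c' : {c | ok c},
    R nc.1 (sval nc.2) (sval c').
  move=> [n [c okc]].
  by have [c' okc' Rc] := step n c okc; exists (exist _ c' okc').
pose Q := fix Q n := if n is m.+1 then f (m, Q m) else exist _ c0 ok0.
exists (sval \o Q); split=> // n; [exact: svalP (Q n)|exact: (fP (n, Q n))].
Qed.

Definition enum_rat (n : nat) : rat := odflt 0 (unpickle n).

Lemma enum_ratK : cancel pickle enum_rat.
Proof. by move=> x; rewrite /enum_rat pickleK. Qed.

(** * Back and forth between maps with open fibres *)

(** Inside D every fibre of t is a convex set without endpoints, hence a copy of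
    the rationals whenever it is nonempty. *)
Definition open_fibres (D : set rat) (t : rat -> rat) :=
  (forall y, D y -> (exists y1, [/\ D y1, y1 < y & t y1 = t y]) /\
                    (exists y2, [/\ D y2, y < y2 & t y2 = t y])) /\
  (forall x y z, D x -> D z -> t x = t z -> x < y -> y < z -> D y).

(** The one-point extension step: a fibre has room for a new point between two
    finite sets, because it is dense in itself and has no endpoints. *)
Lemma fibre_between (D : set rat) (t : MQ) d (A U : seq rat) :
  open_fibres D t -> D d ->
  (forall a, a \in A -> t a <= t d) -> (forall u, u \in U -> t d <= t u) ->
  (forall a, a \in A -> D a) -> (forall u, u \in U -> D u) ->
  (forall a u, a \in A -> u \in U -> a < u) ->
  exists y, [/\ D y, t y = t d, forall a, a \in A -> a < y &
                forall u, u \in U -> y < u].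
Proof.
move=> [Dop Dcvx] Dd; pose fib y := D y /\ t y = t d.
have fib_lo y : fib y -> exists2 z, fib z & z < y.
  move=> [Dy ty]; have [[z [Dz zy tz]] _] := Dop y Dy.
  by exists z => //; split; rewrite ?tz.
have fib_hi y : fib y -> exists2 z, fib z & y < z.
  move=> [Dy ty]; have [_ [z [Dz zy tz]]] := Dop y Dy.
  by exists z => //; split; rewrite ?tz.
have fib_cvx x y z : fib x -> fib z -> x < y -> y < z -> fib y.
  move=> [Dx tx] [Dz tz] xy yz; split; first by apply: Dcvx xy yz => //; rewrite tx.
  by apply/eqP; rewrite eq_le -{1}tz -tx !MQ_le// ltW.
move=> At Ut AD UD AU.
have [l0 fl0 l0U] : exists2 l, fib l & forall u, u \in U -> l < u.
  elim: U Ut UD {AU} => [_ _|u U IH Ut UD]; first by exists d.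
  have [||l fl lU] := IH; first by move=> v vU; apply: Ut; rewrite inE vU orbT.
    by move=> v vU; apply: UD; rewrite inE vU orbT.
  have [lu|ul] := ltP l u.
    by exists l => // v; rewrite inE => /predU1P[->//|]; exact: lU.
  have fu : fib u.
    split; first by apply: UD; rewrite mem_head.
    apply/eqP; rewrite eq_le Ut ?mem_head// andbT -(fl.2).
    exact: MQ_le.
  have [z fz zu] := fib_lo u fu.
  exists z => // v; rewrite inE => /predU1P[->//|vU].
  by apply: lt_trans (lU v vU); exact: lt_le_trans zu ul.
have [l [fl Al lU]] : exists l, [/\ fib l, forall a, a \in A -> a <= l &
    forall u, u \in U -> l < u].
  elim: A At AD AU => [_ _ _|a A IH At AD AU]; first by exists l0.
  have [|||l [fl Al lU]] := IH.
  - by move=> v vA; apply: At; rewrite inE vA orbT.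
  - by move=> v vA; apply: AD; rewrite inE vA orbT.
  - by move=> v u vA; apply: AU; rewrite inE vA orbT.
  have [al|la] := leP a l.
    by exists l; split=> // v; rewrite inE => /predU1P[->//|]; exact: Al.
  exists a; split.
  - split; first by apply: AD; rewrite mem_head.
    apply/eqP; rewrite eq_le At ?mem_head//= -(fl.2).
    by apply: MQ_le; exact: ltW.
  - move=> v; rewrite inE => /predU1P[->//|vA].
    exact: le_trans (Al v vA) (ltW la).
  - by move=> u uU; apply: AU => //; rewrite mem_head.
have [y [fy ly yU]] : exists y, [/\ fib y, l < y & forall u, u \in U -> y < u].
  elim: U lU {l0U Ut UD AU} => [_|u U IH lU].
    by have [z fz lz] := fib_hi l fl; exists z.
  have [|y [fy ly yU]] := IH.
    by move=> v vU; apply: lU; rewrite inE vU orbT.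
  have lu : l < u by apply: lU; rewrite mem_head.
  have [yu|uy] := ltP y u.
    by exists y; split=> // v; rewrite inE => /predU1P[->//|]; exact: yU.
  have lm : l < (l + u) / 2 by lra.
  have mu : (l + u) / 2 < u by lra.
  have my : (l + u) / 2 < y by apply: lt_le_trans uy.
  exists ((l + u) / 2); split=> //; first exact: fib_cvx lm my.
  move=> v; rewrite inE => /predU1P[->//|vU].
  exact: lt_trans my (yU v vU).
case: fy => Dy ty; exists y; split=> // a aA.
exact: le_lt_trans (Al a aA) ly.
Qed.

Definition partial_iso (D1 : set rat) (t1 : rat -> rat) (D2 : set rat)
    (t2 : rat -> rat) (q : seq (rat * rat)) :=
  (forall p, p \in q -> [/\ D1 p.1, D2 p.2 & t1 p.1 = t2 p.2]) /\
  {in q &, forall p p', (p.1 < p'.1) = (p.2 < p'.2)}.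

Definition swap (p : rat * rat) := (p.2, p.1).

Lemma partial_iso_swap D1 t1 D2 t2 q :
  partial_iso D1 t1 D2 t2 q -> partial_iso D2 t2 D1 t1 (map swap q).
Proof.
move=> [q1 q2]; split.
  by move=> _ /mapP[p pq ->]; have [? ? ?] := q1 p pq; split.
by move=> _ _ /mapP[p pq ->] /mapP[p' p'q ->]; rewrite /= q2.
Qed.

Lemma map_swapK : involutive (map swap).
Proof. by elim=> //= -[x y] q ->. Qed.

Lemma partial_iso_forth D1 (t1 : MQ) D2 (t2 : MQ) q x :
  open_fibres D2 t2 -> (forall x, D1 x -> exists2 y, D2 y & t2 y = t1 x) ->
  partial_iso D1 t1 D2 t2 q -> D1 x ->
  exists y, partial_iso D1 t1 D2 t2 ((x, y) :: q).
Proof.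
move=> D2op im [q1 q2] D1x.
have inj p p' : p \in q -> p' \in q -> p.1 = p'.1 -> p.2 = p'.2.
  by move=> pq p'q e; apply: le_anti; rewrite !leNgt -!q2// e ltxx.
have [[p pq px]|xq] := pselect (exists2 p, p \in q & p.1 = x).
  exists p.2; split.
    by move=> p'; rewrite inE => /predU1P[->|/q1//]; have := q1 p pq; rewrite /= px.
  have e : (x, p.2) = p by rewrite -px; case: (p).
  by rewrite e => u v; rewrite !inE => /predU1P[->|uq] /predU1P[->|vq]; apply: q2.
have xq' p : p \in q -> p.1 != x.
  by move=> pq; apply/eqP => px; apply: xq; exists p.
have [d D2d td] := im x D1x.
pose A := [seq p.2 | p <- q & p.1 < x]; pose U := [seq p.2 | p <- q & x < p.1].
have AP a : a \in A -> exists p, [/\ p \in q, p.1 < x & a = p.2].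
  by move=> /mapP[p]; rewrite mem_filter => /andP[px pq] ->; exists p.
have UP a : a \in U -> exists p, [/\ p \in q, x < p.1 & a = p.2].
  by move=> /mapP[p]; rewrite mem_filter => /andP[px pq] ->; exists p.
have [|||||y [D2y ty Ay yU]] := @fibre_between D2 t2 d A U D2op D2d.
- move=> a /AP[p [pq px ->]]; have [_ _ <-] := q1 p pq.
  by rewrite td; apply: MQ_le; exact: ltW.
- move=> a /UP[p [pq px ->]]; have [_ _ <-] := q1 p pq.
  by rewrite td; apply: MQ_le; exact: ltW.
- by move=> a /AP[p [pq px ->]]; have [] := q1 p pq.
- by move=> a /UP[p [pq px ->]]; have [] := q1 p pq.
- move=> a u /AP[p [pq px ->]] /UP[p' [p'q p'x ->]].
  by rewrite -q2//; exact: lt_trans px p'x.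
have yP p : p \in q -> ((x < p.1) = (y < p.2)) /\ ((p.1 < x) = (p.2 < y)).
  move=> pq; have [px|px|px] := ltgtP p.1 x.
  - have : p.2 < y by apply: Ay; apply/mapP; exists p; rewrite // mem_filter px.
    by case: ltgtP.
  - have : y < p.2 by apply: yU; apply/mapP; exists p; rewrite // mem_filter px.
    by case: ltgtP.
  - by have := xq' p pq; rewrite px eqxx.
exists y; split.
  by move=> p; rewrite inE => /predU1P[->|/q1//]; rewrite /= ty.
move=> u v; rewrite !inE => /predU1P[->|uq] /predU1P[->|vq] /=.
- by rewrite !ltxx.
- by have [] := yP v vq.
- by have [] := yP u uq.
- exact: q2.
Qed.

(** Cantor's theorem, fibre by fibre. The subsets D1 and D2 of the rationals
    allow the two orders to be different copies of the rationals. *)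
Lemma back_and_forth D1 (t1 : MQ) D2 (t2 : MQ) q0 :
  open_fibres D1 t1 -> open_fibres D2 t2 ->
  (forall x, D1 x -> exists2 y, D2 y & t2 y = t1 x) ->
  (forall y, D2 y -> exists2 x, D1 x & t1 x = t2 y) ->
  partial_iso D1 t1 D2 t2 q0 ->
  exists a b : rat -> rat,
    [/\ forall x, D1 x -> [/\ D2 (a x), b (a x) = x & t2 (a x) = t1 x],
        forall y, D2 y -> D1 (b y) /\ a (b y) = y,
        forall x y, D1 x -> D1 y -> x < y -> a x < a y &
        forall p, p \in q0 -> a p.1 = p.2].
Proof.
move=> op1 op2 im1 im2 q0P.
pose R n (q q' : seq (rat * rat)) := [/\ {subset q <= q'},
  D1 (enum_rat n) -> exists2 p, p \in q' & p.1 = enum_rat n &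
  D2 (enum_rat n) -> exists2 p, p \in q' & p.2 = enum_rat n].
have step n q : partial_iso D1 t1 D2 t2 q ->
    exists2 q', partial_iso D1 t1 D2 t2 q' & R n q q'.
  move=> qP.
  have [q1 [q1P qq1 q1n]] : exists q1, [/\ partial_iso D1 t1 D2 t2 q1,
      {subset q <= q1} &
      D1 (enum_rat n) -> exists2 p, p \in q1 & p.1 = enum_rat n].
    have [D1n|D1n] := pselect (D1 (enum_rat n)); last by exists q; split.
    have [y yP] := partial_iso_forth op2 im1 qP D1n.
    exists ((enum_rat n, y) :: q); split=> //.
      by move=> p pq; rewrite inE pq orbT.
    by exists (enum_rat n, y); rewrite ?mem_head.
  have [D2n|D2n] := pselect (D2 (enum_rat n)); last by exists q1.
  have [x /partial_iso_swap xP] :=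
    partial_iso_forth op1 im2 (partial_iso_swap q1P) D2n.
  rewrite /= map_swapK /swap/= in xP.
  exists ((x, enum_rat n) :: q1) => //; split.
  - by move=> p /qq1 pq; rewrite inE pq orbT.
  - by move=> /q1n[p pq1 pn]; exists p; rewrite // inE pq1 orbT.
  - by move=> _; exists (x, enum_rat n); rewrite ?mem_head.
have [Q [Q0 QP QR]] := dependent_chain step q0P.
have Qle m n : (m <= n)%N -> {subset Q m <= Q n}.
  elim: n => [|n IH]; first by rewrite leqn0 => /eqP ->.
  rewrite leq_eqVlt => /predU1P[->//|mn] p /(IH mn).
  by have [QQ _ _] := QR n; exact: QQ.
pose G p := exists n, p \in Q n.
have G1 p : G p -> [/\ D1 p.1, D2 p.2 & t1 p.1 = t2 p.2].
  by move=> [n pn]; have [+ _] := QP n; apply.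
have G2 p p' : G p -> G p' -> (p.1 < p'.1) = (p.2 < p'.2).
  move=> [m pm] [n pn]; have [_] := QP (maxn m n); apply.
    by apply: Qle pm; exact: leq_maxl.
  by apply: Qle pn; exact: leq_maxr.
have Gfun p p' : G p -> G p' -> p.1 = p'.1 -> p.2 = p'.2.
  by move=> pq p'q e; apply: le_anti; rewrite !leNgt -!G2// e ltxx.
have Ginj p p' : G p -> G p' -> p.2 = p'.2 -> p.1 = p'.1.
  by move=> pq p'q e; apply: le_anti; rewrite !leNgt !G2// e ltxx.
have Gdom x : D1 x -> exists y, G (x, y).
  move=> D1x; have [_ + _] := QR (pickle x); rewrite enum_ratK => /(_ D1x)[[z y] p /= <-].
  by exists y, (pickle x).+1.
have Gcod y : D2 y -> exists x, G (x, y).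
  move=> D2y; have [_ _] := QR (pickle y); rewrite enum_ratK => /(_ D2y)[[x z] p /= <-].
  by exists x, (pickle y).+1.
have /choice[a aP] : forall x, exists y, D1 x -> G (x, y).
  move=> x; have [/Gdom[y xy]|D1x] := pselect (D1 x); first by exists y.
  by exists 0.
have /choice[b bP] : forall y, exists x, D2 y -> G (x, y).
  move=> y; have [/Gcod[x xy]|D2y] := pselect (D2 y); first by exists x.
  by exists 0.
exists a, b; split.
- move=> x D1x; have [_ /= D2x txy] := G1 _ (aP x D1x); split=> //.
  exact: (Ginj _ _ (bP _ D2x) (aP x D1x)).
- move=> y D2y; have [/= D1y _ _] := G1 _ (bP y D2y); split=> //.
  exact: (Gfun _ _ (aP _ D1y) (bP y D2y)).
- by move=> x y D1x D1y; rewrite (G2 _ _ (aP x D1x) (aP y D1y)).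
- move=> p pq; have Gp : G p by exists 0%N; rewrite Q0.
  have [D1p _ _] := G1 p Gp.
  exact: (Gfun _ _ (aP _ D1p) Gp).
Qed.

(** Surjective maps whose fibres have no endpoints. They form a single orbit
    under composition with automorphisms on the right, and it will turn out
    that they are residual for every topology under consideration. *)
Definition generic (t : MQ) :=
  (forall p, exists x, t x = p) /\
  (forall x, (exists2 y, y < x & t y = t x) /\ (exists2 y, x < y & t y = t x)).

Lemma generic_open_fibres t : generic t -> open_fibres setT t.
Proof.
move=> [_ tE]; split=> // y _; have [[y1 y1y ty1] [y2 y2y ty2]] := tE y.
by split; [exists y1|exists y2].
Qed.

Lemma aut_of_back_and_forth (t1 t2 : MQ) q :
  open_fibres setT t1 -> open_fibres setT t2 ->
  (forall x, exists y, t2 y = t1 x) -> (forall y, exists x, t1 x = t2 y) ->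
  partial_iso setT t1 setT t2 q ->
  exists a : aut, (forall x, t2 (a x) = t1 x) /\
    (forall p, p \in q -> a p.1 = p.2).
Proof.
move=> op1 op2 im1 im2 qP.
have [||a [b [aP bP amono aq]]] := back_and_forth op1 op2 _ _ qP.
- by move=> x _; have [y yx] := im1 x; exists y.
- by move=> x _; have [y yx] := im2 x; exists y.
have bK y : a (b y) = y by have [] := bP y I.
have aK x : b (a x) = x by have [] := aP x I.
have ah : {homo a : x y / x <= y}.
  by move=> x y; rewrite le_eqVlt => /predU1P[->//|xy]; exact/ltW/amono.
have [g ga] := aut_of_bijection ah aK bK.
exists g; split=> [x|p pq]; rewrite ga; last exact: aq.
by have [] := aP x I.
Qed.

(** Two generic maps that agree on a finite set differ by an automorphism fixing
    that set: take for q the identity of the set. *)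
Lemma generic_homogeneous t1 t2 q : generic t1 -> generic t2 ->
  partial_iso setT t1 setT t2 q ->
  exists a : aut, (forall x, t2 (a x) = t1 x) /\
    (forall p, p \in q -> a p.1 = p.2).
Proof.
move=> g1 g2; apply: aut_of_back_and_forth; try exact: generic_open_fibres.
  by move=> x; exact: (g2.1 (t1 x)).
by move=> x; exact: (g1.1 (t2 x)).
Qed.

(** Back and forth for the constant map, whose only fibre is everything. *)
Lemma aut_extend (q : seq (rat * rat)) :
  {in q &, forall p p', (p.1 < p'.1) = (p.2 < p'.2)} ->
  exists a : aut, forall p, p \in q -> a p.1 = p.2.
Proof.
move=> qP.
have op : open_fibres setT (MQ_cst 0).
  split=> // y _; split; first by exists (y - 1); split=> //; lra.
  by exists (y + 1); split=> //; lra.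
have im (x : rat) : exists y, MQ_cst 0 y = MQ_cst 0 x by exists 0.
have qiso : partial_iso setT (MQ_cst 0) setT (MQ_cst 0) q by split.
have [a [_ aq]] := aut_of_back_and_forth op op im im qiso.
by exists a.
Qed.

(** * Countable covers of the automorphism group *)

(** A countable cover of the group by sets G k with (G k)^-1 (G k) inside V. It
    plays the role of the countably many translates of a neighbourhood of the
    identity in a second countable group, but is available although inversion
    need not be continuous. *)
Definition aut_cover (V : set MQ) (G : nat -> aut -> Prop) :=
  (forall g, exists k, G k g) /\
  (forall k g h, G k g -> G k h -> V (autM (autV g) h)).

Definition approximates_stabiliser (V : set MQ) (F : seq rat) :=
  forall (a : aut) (X : seq rat), fixes a [set` F] ->
    exists w : aut, [/\ V w, V (autV w), fixes w [set` F] &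
      forall x, x \in X -> w x = a x].

(** Some G n is dense, for the pointwise topology, in a nonempty open set of
    automorphisms; otherwise a descending sequence of conditions (g, F), each
    standing for the automorphisms that agree with g on F, would produce an
    automorphism outside every G n. Quotients of elements of G n are then dense
    in the stabiliser of the F of that open set. *)
Lemma cover_approximates V G : aut_cover V G ->
  exists F : seq rat, approximates_stabiliser V F.
Proof.
move=> [Gcov GV]; apply: contrapT => noF.
pose ext (c c' : aut * seq rat) :=
  {in c.2, c'.1 =1 c.1} /\ {subset c.2 <= c'.2}.
pose avoids n (c : aut * seq rat) :=
  forall h, G n h -> ~ {in c.2, h =1 c.1}.
pose R n (c c' : aut * seq rat) := [/\ ext c c', avoids n c',
  enum_rat n \in c'.2 & bwd c'.1 (enum_rat n) \in c'.2].
have step n c : True -> exists2 c', True & R n c c'.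
  move=> _; have [[g1 F1] [[/= g1g FF1] g1n]] : exists c', ext c c' /\ avoids n c'.
    apply: contrapT => nc'; apply: noF; exists c.2 => a X aF.
    have near c' : ext c c' -> exists2 h, G n h & {in c'.2, h =1 c'.1}.
      move=> cc'; apply: contrapT => nh; apply: nc'; exists c'; split=> // h Gh hc'.
      by apply: nh; exists h.
    have [|h0 Gh0 h0c] := near c; first by split.
    have [|h Gh hP] := near (autM h0 a, c.2 ++ X).
      split=> /= x xF; last by rewrite mem_cat xF.
      by rewrite autME aF// h0c.
    have wE x : x \in c.2 ++ X -> autM (autV h0) h x = a x.
      by move=> xX; rewrite autME hP//= autME autKV.
    exists (autM (autV h0) h); split.
    - exact: GV Gh0 Gh.
    - exact: GV Gh Gh0.
    - by move=> x xF; rewrite wE ?aF// mem_cat (xF : x \in _).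
    - by move=> x xX; rewrite wE// mem_cat xX orbT.
  exists (g1, [:: enum_rat n, bwd g1 (enum_rat n) & F1]) => //; split=> /=.
  - by split=> // x /FF1; rewrite !inE => ->; rewrite !orbT.
  - by move=> h /g1n hg1 /= hF; apply: hg1 => x /= xF; rewrite hF// !inE xF !orbT.
  - by rewrite mem_head.
  - by rewrite !inE eqxx orbT.
have [Q [_ _ QR]] := @dependent_chain _ (fun=> True) R step (aut1, [::]) I.
have Qext m n : (m <= n)%N -> ext (Q m) (Q n).
  elim: n => [|n IH]; first by rewrite leqn0 => /eqP ->; split.
  rewrite leq_eqVlt => /predU1P[->|mn]; first by split.
  have [mn1 mn2] := IH mn; have [[nn1 nn2] _ _ _] := QR n.
  by split=> x xm; [rewrite nn1 ?mn1// mn2|rewrite nn2// mn2].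
pose a x := (Q (pickle x).+1).1 x; pose b x := bwd (Q (pickle x).+1).1 x.
have aE n x : x \in (Q n).2 -> a x = (Q n).1 x.
  move=> xn; have [_ _ + _] := QR (pickle x); rewrite enum_ratK => xm.
  have [/(_ x xn) <- _] := Qext _ _ (leq_maxl n (pickle x).+1).
  by have [/(_ x xm) -> _] := Qext _ _ (leq_maxr n (pickle x).+1).
have xQ x : x \in (Q (pickle x).+1).2.
  by have [_ _ + _] := QR (pickle x); rewrite enum_ratK.
have bQ x : b x \in (Q (pickle x).+1).2.
  by have [_ _ _] := QR (pickle x); rewrite enum_ratK.
have bK : cancel b a by move=> x; rewrite (aE _ _ (bQ x)) bwdK.
have ah : {homo a : x y / x <= y}.
  move=> x y xy; pose m := maxn (pickle x).+1 (pickle y).+1.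
  rewrite (aE m) ?(aE m y) ?aut_le//.
    by apply: (Qext _ _ (leq_maxr _ _)).2; exact: xQ.
  by apply: (Qext _ _ (leq_maxl _ _)).2; exact: xQ.
have a_inj : injective a.
  move=> x y; pose m := maxn (pickle x).+1 (pickle y).+1.
  rewrite (aE m) ?(aE m y).
  - by move=> /(congr1 (bwd (Q m).1)); rewrite !fwdK.
  - by apply: (Qext _ _ (leq_maxr _ _)).2; exact: xQ.
  - by apply: (Qext _ _ (leq_maxl _ _)).2; exact: xQ.
have aK : cancel a b by move=> x; apply: a_inj; rewrite bK.
have [g ga] := aut_of_bijection ah aK bK.
have [n Gn] := Gcov g; have [_ avn _ _] := QR n.
by apply: (avn g Gn) => x xn; rewrite ga (aE _ _ xn).
Qed.

(** Diagonalisation over disjoint pieces: if for every k some a k could not be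
    matched on Y k, then patching the a k, each translated into its G k, would
    give an automorphism outside every G k. The points of Z are fixed
    throughout; as they separate the pieces, the patching is possible. *)
Lemma cover_matches_piece V G (Z : set rat) (Y : nat -> set rat) : aut_cover V G ->
  (forall i j x, Y i x -> Y j x -> i = j) ->
  (forall k x y, x < y -> ~ (Y k x <-> Y k y) ->
    exists z, [/\ Z z, x < z & z <= y]) ->
  exists k, forall a, fixes a Z -> exists b : aut,
    [/\ V b, fixes b Z & forall x, Y k x -> b x = a x].
Proof.
move=> [Gcov GV] Ydisj Zsep; apply: contrapT => noK.
have /choice[a aP] : forall k, exists a : aut, fixes a Z /\
    ~ exists b : aut, [/\ V b, fixes b Z & forall x, Y k x -> b x = a x].
  move=> k; apply: contrapT => nok; apply: noK; exists k => a aZ.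
  by apply: contrapT => nb; apply: nok; exists a.
have /choice[d dP] : forall k, exists d : aut, fixes d Z /\
    forall g, G k g -> fixes g Z -> G k d.
  move=> k; have [[g [Gg gZ]]|ng] := pselect (exists g, G k g /\ fixes g Z).
    by exists g.
  by exists aut1; split=> // g Gg gZ; exfalso; apply: ng; exists g.
have /choice[c cP] : forall x, exists k : option nat,
    forall i, Y i x <-> k = Some i.
  move=> x; have [[k Yk]|nk] := pselect (exists k, Y k x).
    by exists (Some k) => i; split=> [/(Ydisj _ _ _ Yk)->//|[<-]].
  by exists None => i; split=> // Yi; exfalso; apply: nk; exists i.
pose f k := if k is Some i then autM (d i) (a i) else aut1.
have fZ k : fixes (f k) Z.
  by case: k => [k|//]; apply: fixesM; [exact: (dP k).1|exact: (aP k).1].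
have [x y xy cxy|g gE] := @glue_aut _ c f.
  have [k Yk] : exists k, ~ (Y k x <-> Y k y).
    apply: contrapT => nk; apply: cxy.
    have Yxy k : Y k x <-> Y k y by apply: contrapT => nY; apply: nk; exists k.
    case cx : (c x) => [i|].
      by symmetry; apply/cP/Yxy/cP.
    case cy : (c y) => [i|//].
    by rewrite -cx; apply/cP/Yxy/cP.
  have [z [Zz xz zy]] := Zsep k x y xy Yk.
  by exists z, z; split=> //; exact: fZ.
have [k Gk] := Gcov g.
have gZ : fixes g Z by move=> x Zx; rewrite gE fZ.
apply: (aP k).2; exists (autM (autV (d k)) g); split.
- exact: GV ((dP k).2 g Gk gZ) Gk.
- by apply: fixesM gZ; apply: fixesV; exact: (dP k).1.
- by move=> x /cP cx; rewrite autME gE cx/= autKV.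
Qed.

(** * Generic maps are residual *)

Lemma real_pigeonhole (R : realType) (f : R -> nat) :
  exists A : nat -> R, [/\ injective A, forall i, 0 <= A i < 1 &
    forall i, f (A i) = f (A 0%N)].
Proof.
pose S k := [set x : R | 0 <= x < 1 /\ f x = k].
have [k Sk] : exists k, infinite_set (S k).
  apply: contrapT => nk.
  have : countable (`[0%R, 1%R[%classic : set R).
    have -> : `[0%R, 1%R[%classic = \bigcup_k S k :> set R.
      apply/seteqP; split=> x /=; first by rewrite in_itv/= => x01; exists (f x).
      by move=> [k _ [x01 _]]; rewrite in_itv.
    apply: bigcup_countable => // k _; apply: finite_set_countable.
    by apply: contrapT => ?; apply: nk; exists k.
  move=> /countable_lebesgue_measure0; rewrite lebesgue_measure_itv/= lte_fin ltr01.
  by rewrite oppr0 adde0 => /eqP; rewrite onee_eq0.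
have /infiniteP/card_leP[A] := Sk.
pose B i : R := val (A (exist _ i (in_setT i))).
have BS i : S k (B i) by exact: set_mem (valP (A _)).
exists B; split=> [i j|i|i].
- move=> /val_inj/inj; rewrite !in_setT => /(_ isT isT) e.
  exact: (congr1 (fun z => \val z) e).
- by have [] := BS i.
- by have [_ ->] := BS i; have [_ ->] := BS 0%N.
Qed.

(** What the uniqueness argument uses of the topology: a countable base B, given
    as a sequence of sets, for which composition is jointly continuous, the
    cylinders are open, and the space is Baire and regular. *)
Record semigroup_base (B : nat -> set MQ) : Prop := SemigroupBase {
  base_comp : forall k f g, B k (MQ_comp f g) ->
    exists i j, [/\ B i f, B j g &
      forall f' g', B i f' -> B j g' -> B k (MQ_comp f' g')];
  base_pointwise : forall f x, exists2 k, B k f & forall g, B k g -> g x = f x;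
  base_meet : forall i j f, B i f -> B j f ->
    exists2 k, B k f & forall g, B k g -> B i g /\ B j g;
  base_baire : forall U : nat -> set MQ,
    (forall n f, U n f -> exists2 k, B k f & B k `<=` U n) ->
    (forall n k f, B k f -> exists2 g, B k g & U n g) ->
    forall k f, B k f -> exists2 g, B k g & forall n, U n g;
  base_regular : forall k f, B k f -> exists2 j, B j f &
    forall g, (forall i, B i g -> exists2 h, B i h & B j h) -> B k g }.

(** The only trace of the topology needed to fill a gap: continuity of left
    translations at preimages of V, with countably many neighbourhoods. Stated
    for an arbitrary sequence of sets, it is invariant under reflection. *)
Definition left_base (B : nat -> set MQ) (V : set MQ) :=
  forall f g, V (MQ_comp f g) ->
    exists2 k, B k g & forall g', B k g' -> V (MQ_comp f g').

(** Every neighbourhood of s contains a map that takes the value p in the gap of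
    s to the left of U. For each real z, factor s as s' o t', where t' maps U
    onto the part C z of U beyond a cut and s' is constant with value p on the
    part of U before that cut. As there are uncountably many cuts and
    only countably many basic neighbourhoods, cuts z < z' share a neighbourhood
    of their second factors; composing the first factor for z' with the second
    factor for z gives the required map, since the image of the latter meets
    the interval between the two cuts. *)
Lemma move_into_gap (R : realType) (B : nat -> set MQ) (V : set MQ) (s : MQ)
    (U : set rat) (p : rat) :
  left_base B V -> V s ->
  (forall x y, U x -> x <= y -> U y) -> (exists x, U x) ->
  (forall y, U y -> exists2 x, U x & x < y) ->
  (forall x, ~ U x -> s x <= p) -> (forall x, U x -> p <= s x) ->
  exists v, [/\ V v, forall x, ~ U x -> v x = s x & exists2 y, U y & v y = p].
Proof.
move=> BV Vs Uup [u Uu] Uopen Lp pU.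
pose C (z : R) : set rat := [set y | ratr u + z < ratr y].
have CU z y : 0 <= z -> C z y -> U y.
  move=> z0 Cy; apply: Uup Uu _; apply/ltW; rewrite -(ltr_rat R).
  by apply: le_lt_trans Cy; rewrite lerDl.
have LU x y : ~ U x -> U y -> x < y.
  by move=> Ux Uy; rewrite ltNge; apply/negP => yx; apply: Ux; exact: Uup Uy yx.
have Ccut z y : C z y -> exists2 x, C z x & x < y.
  move=> Cy; have /rat_in_itvoo[x] := Cy; rewrite in_itv/= => /andP[ux xy].
  by exists x => //; rewrite -(ltr_rat R).
have Cup z x y : C z x -> x <= y -> C z y.
  by move=> Cx xy; apply: lt_le_trans Cx _; rewrite ler_rat.
have up_open (D : set rat) : (forall x y, D x -> x <= y -> D y) ->
    (forall y, D y -> exists2 x, D x & x < y) -> open_fibres D (MQ_cst 0).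
  move=> Dup Dcut; split=> [y Dy|x y z Dx _ _ xy _]; last exact: Dup Dx (ltW xy).
  split; first by have [x Dx xy] := Dcut y Dy; exists x.
  by exists (y + 1); split=> //; [apply: Dup Dy _; lra|lra].
have /choice[st stP] : forall z : R, exists st : MQ * MQ, 0 <= z ->
    [/\ MQ_comp st.1 st.2 = s,
        forall x, ~ U x -> st.1 x = s x /\ st.2 x = x,
        forall x, U x -> ~ C z x -> st.1 x = p &
        forall y, C z y -> exists2 x, U x & st.2 x = y].
  move=> z; have [z0|z0] := leP 0 z; last by exists (MQ_id, MQ_id).
  have [c Cc] : exists c, C z c.
    by exists (u + (Num.truncn z).+1%:R); rewrite /C/= rmorphD/= ltrD2l ratr_nat truncnS_gt.
  have [|||||a [b [aP bP amono _]]] := @back_and_forth U (MQ_cst 0) (C z) (MQ_cst 0) [::].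
  - exact: up_open.
  - by apply: up_open; [exact: Cup|exact: Ccut].
  - by move=> x _; exists c.
  - by move=> x _; exists u.
  - by split.
  have bmono x y : C z x -> C z y -> x <= y -> b x <= b y.
    move=> Cx Cy xy; rewrite leNgt; apply/negP => yx.
    have [Ubx abx] := bP x Cx; have [Uby aby] := bP y Cy.
    by have := amono _ _ Uby Ubx yx; rewrite abx aby ltNge xy.
  pose tf x := if `[<U x>] then a x else x.
  pose sf y := if `[<C z y>] then s (b y) else if `[<U y>] then p else s y.
  have th : {homo tf : x y / x <= y}.
    move=> x y; rewrite le_eqVlt => /predU1P[->//|xy]; rewrite /tf.
    case: asboolP => Ux; case: asboolP => Uy.
    - exact/ltW/amono.
    - by case: Uy; exact: Uup Ux (ltW xy).
    - by apply/ltW/LU => //; have [Ca _ _] := aP y Uy; exact: CU z0 Ca.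
    - exact: ltW.
  have sh : {homo sf : x y / x <= y}.
    move=> x y xy; rewrite /sf.
    have [Cx|Cx] := asboolP (C z x).
      have Cy := Cup _ _ _ Cx xy.
      by rewrite asboolT//; apply: MQ_le; exact: bmono.
    have [Ux|Ux] := asboolP (U x).
      have Uy := Uup _ _ Ux xy.
      have [Cy|Cy] := asboolP (C z y); last by rewrite asboolT.
      by apply: pU; have [] := bP y Cy.
    have [Cy|Cy] := asboolP (C z y).
      by apply: (le_trans (Lp x Ux)); apply: pU; have [] := bP y Cy.
    have [Uy|Uy] := asboolP (U y); first exact: Lp.
    exact: MQ_le.
  have nCU x : ~ U x -> ~ C z x by move=> Ux Cx; apply: Ux; exact: CU z0 Cx.
  exists (MQ_of sh, MQ_of th) => _; split=> /=.
  - apply: MQ_ext => x; rewrite -[LHS]/(sf (tf x)) /sf /tf.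
    have [Ux|Ux] := asboolP (U x).
      by have [Cax bax _] := aP x Ux; rewrite asboolT// bax.
    by rewrite asboolF ?asboolF//; exact: nCU.
  - move=> x Ux; split; rewrite /MQ_fun/= /sf /tf.
      by rewrite asboolF ?asboolF//; exact: nCU.
    by rewrite asboolF.
  - by move=> x Ux Cx; rewrite /MQ_fun/= /sf asboolF// asboolT.
  - move=> y Cy; have [Uby aby] := bP y Cy.
    by exists (b y) => //; rewrite /MQ_fun/= /tf asboolT.
have /choice[f fP] : forall z : R, exists k, 0 <= z ->
    B k (st z).2 /\ forall g, B k g -> V (MQ_comp (st z).1 g).
  move=> z; have [z0|z0] := leP 0 z; last by exists 0%N.
  have [sE _ _ _] := stP z z0; have := BV (st z).1 (st z).2.
  by rewrite sE => /(_ Vs)[k Bk kV]; exists k.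
have [A [Ainj A01 fA]] := real_pigeonhole f.
have A0 i : 0 <= A i by have /andP[] := A01 i.
(* Two cuts whose second factors lie in the same basic set. *)
have [z [z' [z0 zz' fz]]] : exists z z', [/\ 0 <= z, z < z' & f z = f z'].
  have [A10|A10|/Ainj//] := ltgtP (A 0%N) (A 1%N).
    by exists (A 0%N), (A 1%N); rewrite fA.
  by exists (A 1%N), (A 0%N); rewrite fA.
have z'0 : 0 <= z' by exact: le_trans (ltW zz').
have [sE _ _ sC] := stP z z0; have [_ s'U s'p _] := stP z' z'0.
have [Bz _] := fP z z0; have [_ z'V] := fP z' z'0.
have /rat_in_itvoo[r] : ratr u + z < ratr u + z' by rewrite ltrD2l.
rewrite in_itv/= => /andP[zr rz'].
have [y Uy yr] := sC r zr.
exists (MQ_comp (st z').1 (st z).2); split.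
- by apply: z'V; rewrite -fz.
- move=> x Ux; rewrite -[LHS]/((st z').1 ((st z).2 x)).
  have [_ zU _ _] := stP z z0.
  by rewrite (zU x Ux).2 (s'U x Ux).1.
- exists y => //; rewrite -[LHS]/((st z').1 ((st z).2 y)) yr s'p//.
    by apply: (CU z).
  by apply/negP; rewrite -leNgt ltW.
Qed.

(** Conjugation by the reflection of the rational line, which exchanges left
    and right in the previous lemma. *)
Lemma reflect_subproof (f : MQ) : {homo (fun x => - f (- x)) : x y / x <= y}.
Proof. by move=> x y xy; rewrite lerN2; apply: MQ_le; rewrite lerN2. Qed.

Definition reflect_MQ (f : MQ) : MQ := MQ_of (@reflect_subproof f).

Lemma reflectE f x : reflect_MQ f x = - f (- x). Proof. by []. Qed.

Lemma reflectK : involutive reflect_MQ.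
Proof. by move=> f; apply: MQ_ext => x; rewrite !reflectE !opprK. Qed.

Lemma reflect_comp f g :
  reflect_MQ (MQ_comp f g) = MQ_comp (reflect_MQ f) (reflect_MQ g).
Proof.
apply: MQ_ext => x; rewrite reflectE -[RHS]/(reflect_MQ f (reflect_MQ g x)).
by rewrite !reflectE opprK.
Qed.

Lemma move_into_gap_left (R : realType) (B : nat -> set MQ) (V : set MQ)
    (s : MQ) (L : set rat) (p : rat) :
  left_base B V -> V s ->
  (forall x y, L y -> x <= y -> L x) -> (exists x, L x) ->
  (forall y, L y -> exists2 x, L x & y < x) ->
  (forall x, ~ L x -> p <= s x) -> (forall x, L x -> s x <= p) ->
  exists v, [/\ V v, forall x, ~ L x -> v x = s x & exists2 y, L y & v y = p].
Proof.
move=> BV Vs Lup [l Ll] Lopen Up pL.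
have [|||||||v [Vv vL [y Ly vy]]] := @move_into_gap R
  (fun k => reflect_MQ @^-1` B k) (reflect_MQ @^-1` V) (reflect_MQ s)
  (-%R @^-1` L) (- p).
- move=> f g /=; rewrite reflect_comp => /BV[k Bk kV]; exists k => // g' /kV.
  by rewrite reflect_comp.
- by rewrite /= reflectK.
- by move=> x y /= Lx xy; apply: Lup Lx _; rewrite lerN2.
- by exists (- l); rewrite /= opprK.
- move=> y /= /Lopen[x Lx yx]; exists (- x); first by rewrite opprK.
  by rewrite ltrNl.
- by move=> x /= Lx; rewrite reflectE lerN2; exact: Up.
- by move=> x /= Lx; rewrite reflectE lerN2; exact: pL.
exists (reflect_MQ v); split=> //.
- by move=> x Lx; rewrite reflectE vL/= ?reflectE opprK ?opprK.
- by exists (- y) => //; rewrite reflectE opprK vy opprK.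
Qed.

Lemma base_agree B f (X : seq rat) : semigroup_base B ->
  exists2 k, B k f & forall g, B k g -> {in X, g =1 f}.
Proof.
move=> BB; elim: X => [|x X [k Bk kX]].
  by have [k Bk _] := base_pointwise BB f 0; exists k.
have [j Bj jx] := base_pointwise BB f x.
have [i Bi iP] := base_meet BB Bk Bj; exists i => // g /iP[Bkg Bjg] y.
by rewrite inE => /predU1P[->|]; [exact: jx|exact: kX].
Qed.

Lemma base_left B k : semigroup_base B -> left_base B (B k).
Proof.
move=> BB f g /(base_comp BB)[i [j [Bi Bj ijk]]].
by exists j => // g' Bj'; exact: ijk.
Qed.

Definition dense_open (B : nat -> set MQ) (U : set MQ) :=
  (forall f, U f -> exists2 k, B k f & B k `<=` U) /\
  (forall k f, B k f -> exists2 g, B k g & U g).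

(** Being generic is a countable intersection of pointwise open conditions: to
    take a given value p, and not to have a given x as least or as greatest
    point of its fibre. A map that fails one of them has a one-sided gap at
    which the missing value can be inserted, so each condition is dense. *)
Lemma generic_residual (R : realType) B : semigroup_base B ->
  exists U : nat -> set MQ, (forall n, dense_open B (U n)) /\
    forall g, (forall n, U n g) -> generic g.
Proof.
move=> BB.
pose S0 p := [set t : MQ | exists x, t x = p].
pose S1 (x : rat) := [set t : MQ | exists2 y : rat, y < x & t y = t x].
pose S2 (x : rat) := [set t : MQ | exists2 y : rat, x < y & t y = t x].
pose U n := match unpickle n : option (nat * rat) with
  | Some (0%N, p) => S0 p | Some (1%N, x) => S1 x | Some (_, x) => S2 x
  | None => setT end.
exists U; split=> [n|g gU]; first split=> [g Ug|i s Bs].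
- have [X XP] : exists X : seq rat, forall h : MQ, {in X, h =1 g} -> U n h.
    move: Ug; rewrite /U; case: unpickle => [[[|[|m]] x]|].
    + by move=> [y gy]; exists [:: y] => h hg; exists y; rewrite hg ?mem_head.
    + move=> [y yx gy]; exists [:: y; x] => h hg; exists y => //.
      by rewrite !hg// !inE eqxx ?orbT.
    + move=> [y yx gy]; exists [:: y; x] => h hg; exists y => //.
      by rewrite !hg// !inE eqxx ?orbT.
    + by exists [::].
  have [j Bj jX] := base_agree g X BB.
  by exists j => // h /jX; exact: XP.
- have BL := @base_left B i BB.
  rewrite /U; case: unpickle => [[[|[|m]] x]|].
  + have [sx|sx] := pselect (S0 x s); first by exists s.
    have sD y : ~ x < s y -> s y < x.
      by move=> /negP; rewrite -leNgt le_eqVlt => /predU1P[e|//]; case: sx; exists y.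
    (* The gap of s at x is open either on its right or on its left. *)
    have [[[y Dy] Dmin]|nD] := pselect ((exists y, x < s y) /\
        forall y, x < s y -> exists2 z, x < s z & z < y).
      have [|||||v [Bv _ [z _ vz]]] := @move_into_gap R B (B i) s
        [set y | x < s y] x BL Bs; last by exists v => //; exists z.
      * by move=> u v /= xu uv; apply: lt_le_trans xu _; exact: MQ_le.
      * by exists y.
      * exact: Dmin.
      * by move=> z /sD/ltW.
      * by move=> z /= /ltW.
    have [|||||v [Bv _ [z _ vz]]] := @move_into_gap_left R B (B i) s
      [set y | s y < x] x BL Bs; last by exists v => //; exists z.
    * by move=> u v /= xu uv; apply: le_lt_trans xu; exact: MQ_le.
    * have [[y Dy]|nDy] := pselect (exists y, x < s y); last first.
        by exists 0; apply: sD => D0; apply: nDy; exists 0.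
      apply: contrapT => nL; apply: nD; split; first by exists y.
      move=> u Du; exists (u - 1); last lra.
      by apply: contrapT => /sD su; apply: nL; exists (u - 1).
    * move=> y /= Ly; apply: contrapT => nL; apply: nD; split.
        exists (y + 1); apply: contrapT => /sD sy; apply: nL.
        by exists (y + 1) => //; lra.
      move=> u Du; have yu : y < u by apply: (@MQ_ltW s); exact: lt_trans Ly Du.
      exists ((y + u) / 2); last lra.
      by apply: contrapT => /sD sy; apply: nL; exists ((y + u) / 2) => //; lra.
    * move=> z /= /negP; rewrite -leNgt//.
    * by move=> z /= /ltW.
  + have [|||||v [Bv vs [y yx vy]]] := @move_into_gap_left R B (B i) s
      [set y | y < x] (s x) BL Bs.
    * by move=> u v /= vx uv; exact: le_lt_trans vx.
    * by exists (x - 1) => /=; lra.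
    * by move=> y /= yx; exists ((y + x) / 2) => /=; lra.
    * by move=> y /= /negP; rewrite -leNgt; exact: MQ_le.
    * by move=> y /= /ltW; exact: MQ_le.
    by exists v => //; exists y => //; rewrite vy vs//= ltxx.
  + have [|||||v [Bv vs [y yx vy]]] := @move_into_gap R B (B i) s
      [set y | x < y] (s x) BL Bs.
    * by move=> u v /= vx uv; exact: lt_le_trans uv.
    * by exists (x + 1) => /=; lra.
    * by move=> y /= yx; exists ((y + x) / 2) => /=; lra.
    * by move=> y /= /negP; rewrite -leNgt; exact: MQ_le.
    * by move=> y /= /ltW; exact: MQ_le.
    by exists v => //; exists y => //; rewrite vy vs//= ltxx.
  + by exists s.
split=> [p|x].
  by have := gU (pickle (0%N, p)); rewrite /U pickleK.
split; first by have := gU (pickle (1%N, x)); rewrite /U pickleK.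
by have := gU (pickle (2%N, x)); rewrite /U pickleK.
Qed.

Lemma generic_dense (R : realType) B k f : semigroup_base B -> B k f ->
  exists2 g, B k g & generic g.
Proof.
move=> BB Bf; have [U [Udo Ugen]] := generic_residual R BB.
have [||g Bg gU] := base_baire BB (U := U) _ _ Bf.
- by move=> n; exact: (Udo n).1.
- by move=> n; exact: (Udo n).2.
by exists g => //; exact: Ugen.
Qed.

(** * Matching automorphisms far out *)

Lemma affine_aut (p q : rat) : 0 < p -> exists a : aut, forall x, a x = p * x + q.
Proof.
move=> p0.
have ah : {homo (fun x => p * x + q) : x y / x <= y}.
  by move=> x y xy; rewrite lerD2r ler_pM2l.
have pn0 : p != 0 by rewrite gt_eqF.
have [||a aE] := aut_of_bijection ah (b := fun y => (y - q) / p).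
- by move=> x; field.
- by move=> x; field.
by exists a.
Qed.

(** A partition of the rationals into half-open blocks; lo x, hi x and lev x are
    the endpoints and the level of the block of x. *)
Definition block_partition (lo hi : rat -> rat) (lev : rat -> nat) :=
  forall x, [/\ lo x <= x, x < hi x & forall y, lo x <= y -> y < hi x ->
    [/\ lo y = lo x, hi y = hi x & lev y = lev x]].

Lemma block_sep lo hi lev x y : block_partition lo hi lev -> x < y ->
  [/\ lo x = lo y, hi x = hi y & lev x = lev y] \/ hi x <= lo y.
Proof.
move=> P xy; have [lx xh Px] := P x; have [ly yh Py] := P y.
have [yhx|hxy] := ltP y (hi x).
  by left; have [-> -> ->] := Px y (le_trans lx (ltW xy)) yhx.
right; rewrite leNgt; apply/negP => lyhx.
have [lxly|lylx] := leP (lo x) (lo y).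
  have [e1 e2 e3] := Px _ lxly lyhx.
  have [f1 f2 f3] := Py _ (lexx _) (le_lt_trans ly yh).
  by move: hxy; rewrite -e2 f2 leNgt yh.
have [e1 _ _] := Py x (le_trans (ltW lylx) lx) (lt_trans xy yh).
by move: lylx; rewrite e1 ltxx.
Qed.

Lemma block_lo_hi lo hi lev x : block_partition lo hi lev -> lo (hi x) = hi x.
Proof.
move=> P; have [lx xh Px] := P x; have [lhx _ _] := P (hi x).
have [[_ e _]|h] := block_sep P xh; last by apply: le_anti; rewrite h lhx.
by have [_] := P (hi x); rewrite -e ltxx.
Qed.

(** The identity is g^-1 o g, so joint continuity supplies for every g basic
    neighbourhoods of g and of g^-1 whose product stays in B k; the cover is
    indexed by such pairs. *)
Lemma base_cover B k : semigroup_base B -> B k MQ_id ->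
  exists G, aut_cover (B k) G.
Proof.
move=> BB Bk.
pose G n (g : aut) := exists i j, [/\ unpickle n = Some (i, j), B i g,
  B j (bwd g) & forall f f', B j f -> B i f' -> B k (MQ_comp f f')].
exists G; split.
  move=> g; have gg : MQ_comp (bwd g) g = MQ_id.
    by apply: MQ_ext => x; exact: (fwdK g x).
  have [|j [i [Bj Bi ji]]] := @base_comp B BB k (bwd g) g; first by rewrite gg.
  by exists (pickle (i, j)), i, j; rewrite pickleK.
move=> n g h [i [j [nij Bi Bj ji]]] [i' [j' []]].
by rewrite nij => -[<- <-] Bi' Bj' _; exact: ji.
Qed.

(** The integer formed by the first l binary digits of z: it selects one of the
    2 ^ l rows into which a block of level l is divided. Distinct reals select
    different rows at all sufficiently deep levels. *)
Definition row_code (R : realType) (z : R) (l : nat) : nat :=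
  Num.truncn (2 ^+ l * z).

Lemma row_code_lt (R : realType) (z : R) l : 0 <= z < 1 -> (row_code z l < 2 ^ l)%N.
Proof.
move=> /andP[z0 z1]; rewrite truncn_lt_nat ?mulr_ge0 ?exprn_ge0//.
by rewrite natrX gtr_pMr ?exprn_gt0.
Qed.

Lemma row_code_neq (R : realType) (z z' : R) : 0 <= z -> 0 <= z' -> z != z' ->
  exists m, forall l, (m <= l)%N -> row_code z l != row_code z' l.
Proof.
wlog zz' : z z' / z < z' => [H z0 z'0 zz'|z0 z'0 _].
  have [lt|gt|e] := ltgtP z z'; last by rewrite e eqxx in zz'.
    exact: H.
  have [|m mP] := H z' z gt z'0 z0; first by rewrite eq_sym.
  by exists m => l ml; rewrite eq_sym mP.
exists (Num.bound (z' - z)^-1) => l ml; apply/eqP => e.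
have d0 : 0 < z' - z by rewrite subr_gt0.
have : 1 <= 2 ^+ l * (z' - z).
  rewrite -ler_pdivrMr// div1r -natrX.
  apply: le_trans (ltW (archi_boundP _)) _; first by rewrite invr_ge0 ltW.
  by rewrite ler_nat; apply: leq_trans ml _; apply/ltnW/ltn_expl.
have /andP[a1 a2] : (row_code z l)%:R <= 2 ^+ l * z < (row_code z l).+1%:R.
  by apply: truncn_itv; rewrite mulr_ge0 ?exprn_ge0.
have /andP[b1 b2] : (row_code z' l)%:R <= 2 ^+ l * z' < (row_code z' l).+1%:R.
  by apply: truncn_itv; rewrite mulr_ge0 ?exprn_ge0.
by move: b2; rewrite -e -natr1; lra.
Qed.

Lemma row_code_separate (R : realType) (A : nat -> R) k : injective A ->
  (forall i, 0 <= A i < 1) ->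
  exists m, forall i l, (i < k)%N -> (m <= l)%N ->
    row_code (A i) l != row_code (A k) l.
Proof.
move=> Ainj A01; have A0 i : 0 <= A i by have /andP[] := A01 i.
suff: forall n, (n <= k)%N -> exists m, forall i l, (i < n)%N -> (m <= l)%N ->
    row_code (A i) l != row_code (A k) l by apply.
elim=> [_|n IH nk]; first by exists 0%N.
have [m mP] := IH (ltnW nk).
have [|m' m'P] := @row_code_neq R (A n) (A k) (A0 n) (A0 k).
  by apply/eqP => /Ainj e; rewrite e ltnn in nk.
exists (maxn m m') => i l; rewrite geq_max ltnS => + /andP[ml m'l].
by rewrite leq_eqVlt => /predU1P[->|/mP]; [exact: m'P|exact].
Qed.

Lemma row_unique (c c' : nat) (u t : rat) :
  c%:R * u <= t -> t < c.+1%:R * u -> c'%:R * u <= t -> t < c'.+1%:R * u -> c = c'.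
Proof.
move=> ct tc c't tc'.
have u0 : 0 < u by rewrite -natr1 mulrDl mul1r in tc; lra.
have cc' : (c < c'.+1)%N by rewrite -(ltr_nat rat) -(ltr_pM2r u0); exact: le_lt_trans tc'.
have c'c : (c' < c.+1)%N by rewrite -(ltr_nat rat) -(ltr_pM2r u0); exact: le_lt_trans tc.
by apply/eqP; rewrite eqn_leq; apply/andP; split; rewrite -ltnS.
Qed.

(** Automorphisms that preserve all blocks are matched exactly by elements of
    B k at all sufficiently deep levels, and without disturbing level 0.

    Every real z gives a factorisation of the identity as S o id o K, where K
    contracts each block onto its row selected by z and S expands that row
    again, collapsing the rest of the block. By second countability infinitely
    many reals A q share the same basic neighbourhoods of the three factors;
    let B j be the one of the identity. The rows selected by different A q are
    disjoint at deep levels, so by the diagonal argument there is one A q such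
    that B j contains an element b with prescribed values on all its deep rows.
    What b does outside the rows of A q is invisible in S o b o K. *)
Lemma match_deep_levels (R : realType) B k lo hi lev :
  semigroup_base B -> B k MQ_id -> block_partition lo hi lev ->
  exists n, forall a : aut, (forall x, a (lo x) = lo x) ->
    (forall x, (lev x < n)%N -> a x = x) ->
    exists b : aut, [/\ B k b, forall x, b (lo x) = lo x,
      forall x, lev x = 0%N -> b x = x & forall x, (n <= lev x)%N -> b x = a x].
Proof.
move=> BB Bk P.
have lo_le x : lo x <= x by have [] := P x.
have lt_hi x : x < hi x by have [] := P x.
have lo_hi x : lo x < hi x by exact: le_lt_trans (lo_le x) (lt_hi x).
pose key x : rat * rat * nat := (lo x, hi x, lev x).
have keyP x y : lo x <= y -> y < hi x -> key y = key x.
  by have [_ _ Px] := P x => ly yh; rewrite /key; have [-> -> ->] := Px y ly yh.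
have key_lo x : key (lo x) = key x by apply: keyP.
have sep x y : x < y -> key x = key y \/ hi x <= lo y.
  by move=> /(block_sep P)[[e1 e2 e3]|]; [left; rewrite /key e1 e2 e3|right].
have /choice[Th ThE] : forall zK : R * (rat * rat * nat), exists a : aut,
    forall y, a y = zK.2.1.1 + ((row_code zK.1 zK.2.2)%:R *
      (zK.2.1.2 - zK.2.1.1) + (y - zK.2.1.1)) / 2 ^+ zK.2.2.
  move=> [z [[l h] m]] /=.
  have [|a aE] := @affine_aut (2 ^+ m)^-1
      (l + ((row_code z m)%:R * (h - l) - l) / 2 ^+ m).
    by rewrite invr_gt0 exprn_gt0.
  by exists a => y; rewrite aE; ring.
pose th z x := Th (z, key x).
pose u x := (hi x - lo x) / 2 ^+ lev x.
have u0 x : 0 < u x by rewrite divr_gt0 ?exprn_gt0// subr_gt0.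
have th_lo z x : th z x (lo x) = lo x + (row_code z (lev x))%:R * u x.
  by rewrite ThE/= subrr addr0 mulrA.
have th_hi z x : th z x (hi x) = lo x + (row_code z (lev x)).+1%:R * u x.
  by rewrite ThE/= -natr1 /u; ring.
have uN x : (2 ^ lev x)%:R * u x = hi x - lo x.
  by rewrite natrX /u mulrC divfK// expf_neq0.
have ge_lo z x : lo x <= th z x (lo x).
  by rewrite th_lo lerDl mulr_ge0// ltW.
have le_hi z x : 0 <= z < 1 -> th z x (hi x) <= hi x.
  move=> /(@row_code_lt R z (lev x)) c; rewrite th_hi -lerBrDl -uN ler_pM2r//.
  by rewrite ler_nat.
have th_key z x y : 0 <= z < 1 -> lo x <= y -> y < hi x -> key (th z x y) = key x.
  move=> z01 ly yh; apply: keyP.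
    by apply: le_trans (ge_lo z x) _; exact: MQ_le.
  by apply: lt_le_trans (le_hi z x z01); rewrite aut_lt.
have thk z x y : key x = key y -> th z x = th z y by rewrite /th => ->.
have /choice[SK SKP] : forall z : R, exists p : MQ * MQ, 0 <= z < 1 ->
    (forall x, p.2 x = th z x x) /\
    (forall x y, lo x <= y -> y < hi x -> p.1 (th z x y) = y).
  move=> z; have [z01|z01] := pselect (0 <= z < 1); last by exists (MQ_id, MQ_id).
  have Kh : {homo (fun x => th z x x) : x y / x <= y}.
    move=> x y; rewrite le_eqVlt => /predU1P[->//|xy].
    have [/thk ->|hl] := sep x y xy; first by rewrite aut_le ltW.
    apply: (@le_trans _ _ (th z x (hi x))); first by rewrite aut_le ltW.
    apply: le_trans (le_hi _ _ z01) _; apply: (le_trans hl).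
    by apply: le_trans (ge_lo z y) _; exact: MQ_le.
  pose s y := if y < th z y (lo y) then lo y else
    if th z y (hi y) <= y then hi y else autV (th z y) y.
  have s_lo y : lo y <= s y.
    rewrite /s; case: ltP => // h1; case: (leP (th z y _)) => h2.
      exact: ltW.
    by rewrite -(aut_le (th z y)) autVK.
  have s_hi y : s y <= hi y.
    rewrite /s; case: ltP => h1; first exact: ltW.
    by case: (leP (th z y _)) => // h2; rewrite -(aut_le (th z y)) autVK ltW.
  have sh : {homo s : x y / x <= y}.
    move=> x y; rewrite le_eqVlt => /predU1P[->//|xy].
    have [kxy|hl] := sep x y xy; last exact: le_trans (s_hi x) (le_trans hl (s_lo y)).
    have [e1 e2 _] := kxy.
    have := s_lo y; rewrite /s -(thk _ _ _ kxy) -e1 -e2.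
    case: (ltP x) => // h1 _; have y1 := le_trans h1 (ltW xy).
    rewrite [y < _]ltNge y1 /=.
    case: (leP (th z x (hi x)) x) => h2; first by rewrite (le_trans h2 (ltW xy)).
    case: (leP (th z x (hi x)) y) => h3; last by apply: MQ_le; exact: ltW.
    by rewrite -(aut_le (th z x)) autVK ltW.
  exists (MQ_of sh, MQ_of Kh) => _; split=> // x y ly yh.
  rewrite /= -[LHS]/(s (th z x y)) /s.
  have kxy := th_key z x y z01 ly yh; have [e1 e2 _] := kxy.
  rewrite (thk _ _ _ kxy) e1 e2 aut_lt ltNge ly/= aut_le leNgt yh/=.
  by rewrite autKV.
have /choice[f fP] : forall z : R, exists n : nat, 0 <= z < 1 ->
    exists i j l, [/\ unpickle n = Some (i, j, l), B i (SK z).1, B j MQ_id,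
      B l (SK z).2 & forall f1 f2 f3, B i f1 -> B j f2 -> B l f3 ->
      B k (MQ_comp (MQ_comp f1 f2) f3)].
  move=> z; have [z01|z01] := pselect (0 <= z < 1); last by exists 0%N.
  have [Kz Sz] := SKP z z01.
  have e : MQ_comp (MQ_comp (SK z).1 MQ_id) (SK z).2 = MQ_id.
    apply: MQ_ext => x; rewrite -[LHS]/((SK z).1 ((SK z).2 x)) Kz Sz//.
  have [|m [l [Bm Bl ml]]] := @base_comp B BB k (MQ_comp (SK z).1 MQ_id) (SK z).2.
    by rewrite e.
  have [i [j [Bi Bj ij]]] := base_comp BB Bm.
  exists (pickle (i, j, l)) => _; exists i, j, l; rewrite pickleK; split=> //.
  by move=> f1 f2 f3 B1 B2; apply: ml; exact: ij.
have [A [Ainj A01 fA]] := real_pigeonhole f.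
have [i [j [l [uij _ Bj _ ijl]]]] := fP _ (A01 0%N).
have ASK q : B i (SK (A q)).1 /\ B l (SK (A q)).2.
  have [i' [j' [l' []]]] := fP _ (A01 q).
  by rewrite fA uij => -[<- _ <-].
have [G Gcov] := base_cover BB Bj.
have /choice[m mP] : forall q, exists m, forall i l, (i < q)%N -> (m <= l)%N ->
    row_code (A i) l != row_code (A q) l.
  by move=> q; exact: row_code_separate.
pose Y q y := [/\ (0 < lev y)%N, (m q <= lev y)%N, th (A q) y (lo y) <= y &
  y < th (A q) y (hi y)].
pose Z z := lev z = 0%N \/ exists x (c : nat), (c <= 2 ^ lev x)%N /\
  z = lo x + c%:R * u x.
have Zlo q x : Z (th (A q) x (lo x)).
  by right; exists x, (row_code (A q) (lev x)); rewrite th_lo ltnW// row_code_lt.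
have Zhi q x : Z (th (A q) x (hi x)).
  by right; exists x, (row_code (A q) (lev x)).+1; rewrite th_hi row_code_lt.
have Z_lo x : Z (lo x) by right; exists x, 0%N; rewrite mul0r addr0.
have Yrow q y : Y q y ->
    (row_code (A q) (lev y))%:R * u y <= y - lo y /\
    y - lo y < (row_code (A q) (lev y)).+1%:R * u y.
  by move=> [_ _]; rewrite th_lo th_hi => h1 h2; rewrite lerBrDl ltrBlDl.
have [p q y Yp Yq|q x y xy Yxy|q full] := cover_matches_piece (Z := Z) (Y := Y) Gcov.
- have c : row_code (A p) (lev y) = row_code (A q) (lev y).
    have [p1 p2] := Yrow p y Yp; have [q1 q2] := Yrow q y Yq.
    exact: row_unique p1 p2 q1 q2.
  have [pq|qp|//] := ltngtP p q.
    have [_ mq _ _] := Yq.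
    by have := mP q p (lev y) pq mq; rewrite c eqxx.
  have [_ mp _ _] := Yp.
  by have := mP p q (lev y) qp mp; rewrite c eqxx.
- have [kxy|hl] := sep x y xy; last first.
    by exists (lo y); split=> //; exact: lt_le_trans (lt_hi x) hl.
  have [e1 e2 e3] := kxy.
  apply: contrapT => nz; apply: Yxy; rewrite /Y e1 e2 e3 (thk _ _ _ kxy).
  have nz1 : th (A q) y (lo y) <= x <-> th (A q) y (lo y) <= y.
    split=> [h|h]; first exact: le_trans h (ltW xy).
    rewrite leNgt; apply/negP => h'; apply: nz.
    by exists (th (A q) y (lo y)).
  have nz2 : x < th (A q) y (hi y) <-> y < th (A q) y (hi y).
    split=> [h|h]; last exact: lt_trans h.
    rewrite ltNge; apply/negP => h'; apply: nz.
    by exists (th (A q) y (hi y)).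
  by split=> -[? ? /nz1 ? /nz2 ?].
(* The bound is at least 1, so that a is trivial at level 0 as well. *)
exists (maxn 1 (m q)) => a alo aid.
have ahi x : a (hi x) = hi x by rewrite -(block_lo_hi x P) alo.
(* The automorphism to be matched: a transported to the selected rows. *)
pose g (c : option (rat * rat * nat)) := if c is Some K then
  autM (Th (A q, K)) (autM a (autV (Th (A q, K)))) else aut1.
pose c x := if `[<Y q x>] then Some (key x) else None.
have gSlo x : g (Some (key x)) (th (A q) x (lo x)) = th (A q) x (lo x).
  by rewrite !autME autKV alo.
have gShi x : g (Some (key x)) (th (A q) x (hi x)) = th (A q) x (hi x).
  by rewrite !autME autKV ahi.
have [x y xy cxy|d dE] := @glue_aut _ c g.
  move: cxy; rewrite /c; case: asboolP => Yx; case: asboolP => Yy // cxy.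
  - have [kxy|hl] := sep x y xy; first by rewrite kxy in cxy.
    exists (th (A q) x (hi x)), (th (A q) y (lo y)); split=> //.
    + by have [] := Yx.
    + apply: le_trans (le_hi _ _ (A01 q)) _; apply: (le_trans hl).
      exact: ge_lo.
    + by have [] := Yy.
  - exists (th (A q) x (hi x)), y; split=> //; first by have [] := Yx.
    have [kxy|hl] := sep x y xy; last first.
      apply: le_trans (le_hi _ _ (A01 q)) _; apply: (le_trans hl); exact: lo_le.
    rewrite leNgt; apply/negP => yx; apply: Yy.
    have [e1 e2 e3] := kxy; have [Y1 Y2 Y3 _] := Yx.
    rewrite /Y -e1 -e2 -e3 -(thk _ _ _ kxy); split=> //.
    exact: le_trans Y3 (ltW xy).
  - exists (th (A q) y (lo y)), (th (A q) y (lo y)).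
    have [Y1 Y2 Y3 Y4] := Yy.
    split=> //; have [kxy|hl] := sep x y xy; last first.
      by apply: lt_le_trans (lt_hi x) _; apply: le_trans hl (ge_lo _ _).
    rewrite ltNge; apply/negP => yx; apply: Yx.
    have [e1 e2 e3] := kxy.
    rewrite /Y e1 e2 e3 (thk _ _ _ kxy); split=> //.
    exact: lt_trans Y4.
have Ylo y x (n : nat) : Y q y -> (n <= 2 ^ lev x)%N -> y = lo x + n%:R * u x ->
    y = th (A q) y (lo y).
  move=> Yy + yE; have [_ _ Yl _] := Yy; rewrite leq_eqVlt => /predU1P[n2|n2].
    have yh : y = hi x by rewrite yE n2 uN subrKC.
    apply: le_anti; rewrite Yl andbT {1}yh -(block_lo_hi x P) -yh; exact: ge_lo.
  have kyx : key y = key x.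
    apply: keyP; rewrite yE; first by rewrite lerDl mulr_ge0// ltW.
    by rewrite -ltrBrDl -uN ltr_pM2r// ltr_nat.
  have [e1 e2 e3] := kyx; have uyx : u y = u x by rewrite /u e1 e2 e3.
  have [r1 r2] := Yrow q y Yy.
  have yl : y - lo y = n%:R * u y by rewrite e1 uyx {1}yE addrAC subrr add0r.
  rewrite th_lo -{1}(subrK (lo y) y) yl addrC; congr (_ + _%:R * _).
  apply: row_unique r1 r2; rewrite yl// ltr_pM2r//.
  by rewrite ltr_nat.
have dZ : fixes d Z.
  move=> z Zz; rewrite dE /c; case: asboolP => // Yz.
  have [z0|[x [n [n2 zE]]]] := Zz; first by have [+ _ _ _] := Yz; rewrite z0.
  by rewrite {2 3}(Ylo z x n Yz n2 zE) gSlo.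
have [b [Bb bZ bd]] := full d dZ.
(* On each block, S o b o K is b conjugated by the contraction onto the row. *)
pose g' (K : rat * rat * nat) := autM (autV (Th (A q, K))) (autM b (Th (A q, K))).
have [x y xy kxy|e eE] := @glue_aut _ key g'.
  exists (hi x), (lo y); split=> //.
  - by have [kxy'|//] := sep x y xy.
  - by rewrite !autME bZ ?autKV//; exact: Zhi.
  - by rewrite !autME bZ ?autKV//; exact: Zlo.
have eth x : e x = autV (th (A q) x) (b (th (A q) x x)) by rewrite eE.
have b_lo x : th (A q) x (lo x) <= b (th (A q) x x).
  by rewrite -(bZ _ (Zlo q x)) !aut_le.
have b_hi x : b (th (A q) x x) < th (A q) x (hi x).
  by rewrite -(bZ _ (Zhi q x)) !aut_lt.
have [Kq Sq] := SKP _ (A01 q).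
exists e; split.
- have -> : e = MQ_comp (MQ_comp (SK (A q)).1 b) (SK (A q)).2 :> MQ.
    apply: MQ_ext => x.
    rewrite -[RHS]/((SK (A q)).1 (b ((SK (A q)).2 x))) Kq eth.
    rewrite -[in RHS](autVK (th (A q) x) (b _)) Sq//.
      by rewrite -(aut_le (th (A q) x)) autVK.
    by rewrite -(aut_lt (th (A q) x)) autVK.
  by have [BS BK] := ASK q; exact: ijl.
- move=> x; rewrite eth (thk _ _ _ (key_lo x)) bZ ?autKV//.
- move=> x x0; have xx : th (A q) x x = x.
    rewrite ThE/= x0 /row_code expr0 mul1r divr1.
    rewrite (_ : Num.truncn _ = 0%N) ?mul0r ?add0r ?subrKC//.
    by apply/eqP; rewrite truncn_eq; have /andP[] := A01 q; move=> -> //=.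
  rewrite eth xx bZ; last by left.
  by rewrite -[X in autV _ X]xx autKV.
- move=> x; rewrite geq_max => /andP[x0 xm].
  have kx : key (th (A q) x x) = key x by apply: th_key (A01 q) _ _.
  have [e1 e2 e3] := kx.
  have Yx : Y q (th (A q) x x).
    by rewrite /Y e1 e2 e3 (thk _ _ _ kx); split=> //; rewrite ?aut_le ?aut_lt.
  have gE y : g (Some (key x)) y = th (A q) x (a (autV (th (A q) x) y)) by [].
  by rewrite eth bd// dE /c asboolT// kx gE !autKV.
Qed.

(** * Correcting a generic map *)

Lemma seq_ub (X : seq rat) : exists p, forall x, x \in X -> x < p.
Proof.
elim: X => [|x X [p pX]]; first by exists 0.
exists (Num.max p (x + 1)) => y; rewrite inE lt_max => /predU1P[->|/pX->//].
by rewrite ltrDl ltr01 orbT.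
Qed.

Lemma seq_lb (X : seq rat) : exists p, forall x, x \in X -> p < x.
Proof.
have [p pX] := seq_ub (map -%R X); exists (- p) => x xX.
by rewrite ltrNl; apply: pX; exact: map_f.
Qed.

Lemma base_mul B k f : semigroup_base B -> B k f ->
  exists i j, [/\ B i f, B j MQ_id &
    forall g b, B i g -> B j b -> B k (MQ_comp g b)].
Proof.
move=> BB Bf; have e : MQ_comp f MQ_id = f by apply: MQ_ext.
have [|i [j [Bi Bj ij]]] := @base_comp B BB k f MQ_id; first by rewrite e.
by exists i, j.
Qed.

Definition agree_cofinally (s t : MQ) := forall p,
  (exists2 x, p < x & s x = t x) /\ (exists2 x, x < p & s x = t x).

(** Every neighbourhood contains a map d o w with d generic and w close to the
    identity; by [cover_approximates] w can send some x far out to a point where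
    d takes the value e x. So agreeing with e beyond a given bound is a dense
    open condition. *)
Lemma agree_cofinally_dense (R : realType) B k f e : semigroup_base B ->
  generic e -> B k f -> exists g, [/\ B k g, generic g & agree_cofinally e g].
Proof.
move=> BB egen Bkf; have [U [Udo Ugen]] := generic_residual R BB.
pose W n := [set g : MQ | if (unpickle n : option (bool * rat)) is Some (b, p) then
  exists2 x : rat, if b then p < x else x < p & e x = g x else True].
have Wdo n : dense_open B (W n).
  rewrite /W; case: unpickle => [[b p]|]; last first.
    split=> [h _|j h Bh]; last by exists h.
    by have [j Bj _] := base_agree h [::] BB; exists j.
  split=> [h [x px ex]|j h Bh].
    have [j Bj jx] := base_pointwise BB h x; exists j => // h' Bh'.
    by exists x; [exact: px|rewrite (jx h' Bh')].
  have [i1 [i2 [Bi1 Bi2 i12]]] := base_mul BB Bh.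
  have [G Gcov] := base_cover BB Bi2.
  have [F FP] := cover_approximates Gcov.
  have [d Bd dgen] := generic_dense R BB Bi1.
  suff [x [y [px exy Fxy]]] : exists x y : rat,
      [/\ if b then p < x else x < p, e x = d y &
      forall z, z \in F -> (z < x) = (z < y) /\ (x < z) = (y < z)].
    have [|a aq] := @aut_extend ((x, y) :: [seq (z, z) | z <- F]).
      move=> u v; rewrite !inE.
      move=> /predU1P[->|/mapP[z zF ->]] /predU1P[->|/mapP[z' z'F ->]] //=.
      - by rewrite !ltxx.
      - by have [_ ->] := Fxy z' z'F.
      - by have [-> _] := Fxy z zF.
    have [|w [Bw _ _ wX]] := FP a [:: x].
      by move=> z zF; rewrite (aq (z, z))// inE map_f ?orbT.
    exists (MQ_comp d w); first exact: i12.
    exists x => //; rewrite exy -[RHS]/(d (w x)) wX ?mem_head//.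
    by have -> : a x = y := aq (x, y) (mem_head _ _).
  case: b.
    have [c cP] := seq_ub (e p :: map e F ++ map d F).
    have [x ex] := egen.1 c; have [y dy] := dgen.1 c.
    exists x, y; split; first by apply: (@MQ_ltW e); rewrite ex cP ?mem_head.
      by rewrite ex dy.
    move=> z zF.
    have zx : z < x.
      by apply: (@MQ_ltW e); rewrite ex cP// inE mem_cat (map_f e zF) orbT.
    have zy : z < y.
      by apply: (@MQ_ltW d); rewrite dy cP// inE mem_cat (map_f d zF) !orbT.
    by rewrite zx zy !ltNge !ltW.
  have [c cP] := seq_lb (e p :: map e F ++ map d F).
  have [x ex] := egen.1 c; have [y dy] := dgen.1 c.
  exists x, y; split; first by apply: (@MQ_ltW e); rewrite ex cP ?mem_head.
    by rewrite ex dy.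
  move=> z zF.
  have zx : x < z.
    by apply: (@MQ_ltW e); rewrite ex cP// inE mem_cat (map_f e zF) orbT.
  have zy : y < z.
    by apply: (@MQ_ltW d); rewrite dy cP// inE mem_cat (map_f d zF) !orbT.
  by rewrite zx zy !ltNge !ltW.
have [n|n|g Bg gP] :=
  base_baire BB (U := fun n => if odd n then U n./2 else W n./2) _ _ Bkf.
- by case: (odd n); [exact: (Udo _).1|exact: (Wdo _).1].
- by case: (odd n); [exact: (Udo _).2|exact: (Wdo _).2].
exists g; split=> //.
  by apply: Ugen => n; have := gP n.*2.+1; rewrite /= odd_double/= uphalf_double.
have gW n : W n g by have := gP n.*2; rewrite odd_double/= doubleK.
by move=> p; split; [have := gW (pickle (true, p))|have := gW (pickle (false, p))];
  rewrite /W pickleK.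
Qed.

Lemma generic_locally_constant t x : generic t -> exists2 e, 0 < e &
  forall d, 0 < d -> d <= e -> forall y, x - d <= y -> y <= x + d -> t y = t x.
Proof.
move=> [_ tE]; have [[y1 y1x t1] [y2 xy2 t2]] := tE x.
exists (Num.min (x - y1) (y2 - x)); first by rewrite lt_min !subr_gt0 y1x.
move=> d d0; rewrite le_min => /andP[d1 d2] y xy yx.
apply: le_anti; apply/andP; split; [rewrite -t2|rewrite -t1]; apply: MQ_le; lra.
Qed.

Lemma common_radius (P : nat -> rat -> Prop) r :
  (forall i, exists2 e, 0 < e & forall d, 0 < d -> d <= e -> P i d) ->
  exists2 e, 0 < e & forall i, (i <= r)%N -> P i e.
Proof.
move=> PP; suff [e e0 eP] : exists2 e, 0 < e &
    forall i d, (i <= r)%N -> 0 < d -> d <= e -> P i d.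
  by exists e => // i ir; exact: eP.
elim: r => [|r [e e0 eP]].
  have [e e0 eP] := PP 0%N; exists e => // i d; rewrite leqn0 => /eqP ->.
  exact: eP.
have [e' e'0 e'P] := PP r.+1; exists (Num.min e e'); first by rewrite lt_min e0.
move=> i d; rewrite le_min leq_eqVlt => /predU1P[->|ir] d0 /andP[de de'].
  exact: e'P.
exact: eP.
Qed.

Lemma find_interval (g : nat -> rat) r x : g 0%N <= x -> x < g r ->
  exists i, [/\ (i < r)%N, g i <= x & x < g i.+1].
Proof.
move=> g0; elim: r => [|r IH]; first by rewrite ltNge g0.
move=> xr; have [xr'|xr'] := ltP x (g r); last by exists r.
by have [i [ir gx xg]] := IH xr'; exists i; split=> //; exact: ltnW.
Qed.

(** If e and t agree outside an interval and at the points f i (0 < i < r), which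
    include F, then e is carried to t by w o b o w^-1 with w, w^-1 and b in V.

    The maps e and t are constant near each g i, where g runs through the
    f i and the endpoints of the interval. Let a be an automorphism with
    e o a = t. The blocks between A i k.+1 and A i k.+2 (i < r) form disjoint
    pieces Y k, one for each k, so for some k every automorphism that fixes the
    ends of all blocks is matched on Y k; the element w of V then stretches each block of Y k to all of the
    interval from g i to g i.+1 except short pieces at the ends. There
    w o b o w^-1 coincides with a, and on the short pieces, which it preserves,
    e does not see it. *)
Lemma compact_correction (V : set MQ) G (F : seq rat) (f : nat -> rat) r
    (e t : MQ) (lb ub : rat) :
  aut_cover V G ->
  approximates_stabiliser V F ->
  (1 < r)%N -> (forall i, f i < f i.+1) ->
  (forall z, z \in F -> exists2 i, (0 < i < r)%N & z = f i) ->
  generic e -> generic t -> lb < f 1%N -> f r.-1 < ub ->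
  (forall i, (0 < i < r)%N -> e (f i) = t (f i)) ->
  (forall x, x <= lb -> e x = t x) -> (forall x, ub <= x -> e x = t x) ->
  exists w b : aut, [/\ V w, V (autV w), V b &
    forall x, e (w (b (autV w x))) = t x].
Proof.
move=> Gcov FP r1 fS Ff egen tgen lbf fub etf etlb etub.
have flt i j : (i < j)%N -> f i < f j by exact: homo_ltn lt_trans fS _ _.
have fle i j : (i <= j)%N -> f i <= f j.
  by rewrite leq_eqVlt => /predU1P[->//|/flt/ltW].
pose g i := if i == 0%N then lb else if (i < r)%N then f i else ub + (i - r)%:R.
have gf i : (0 < i < r)%N -> g i = f i.
  by rewrite /g lt0n => /andP[/negbTE -> ->].
have gr : g r = ub by rewrite /g ltnn subnn addr0 gtn_eqF// ltnW.
have gS i : g i < g i.+1.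
  rewrite /g /=; case: i => [|i] /=; first by rewrite r1.
  have [ir|ri] := ltnP i.+2 r; first by rewrite (ltnW ir).
  have [ir|ri'] := ltnP i.+1 r.
    have -> : i.+2 = r by apply/eqP; rewrite eqn_leq ri andbT.
    by rewrite subnn addr0 (le_lt_trans _ fub)// fle// -ltnS prednK// ltnW.
  by rewrite ltrD2l ltr_nat; lia.
have glt i j : (i < j)%N -> g i < g j by exact: homo_ltn lt_trans gS _ _.
have gle i j : (i <= j)%N -> g i <= g j.
  by rewrite leq_eqVlt => /predU1P[->//|/glt/ltW].
have etg i : (i <= r)%N -> e (g i) = t (g i).
  rewrite leq_eqVlt => /predU1P[->|ir]; first by rewrite gr etub.
  case: i ir => [_|i ir]; first exact: etlb.
  have ir' : (0 < i.+1 < r)%N by rewrite ir.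
  by rewrite gf// etf.
have [|d d0 dP] := @common_radius (fun i d => [/\ g i + d < g i.+1 - d,
    forall y, g i - d <= y -> y <= g i + d -> e y = e (g i) &
    forall y, g i - d <= y -> y <= g i + d -> t y = t (g i)]) r.
  move=> i; have [d1 d10 d1P] := generic_locally_constant (g i) egen.
  have [d2 d20 d2P] := generic_locally_constant (g i) tgen.
  exists (Num.min ((g i.+1 - g i) / 3) (Num.min d1 d2)).
    by rewrite !lt_min d10 d20 !andbT; have := gS i; lra.
  move=> d d0; rewrite !le_min => /and3P[dg dd1 dd2]; split.
  - by have := gS i; lra.
  - exact: d1P.
  - exact: d2P.
pose I := iota 0 r.+1.
have Ir i : (i <= r)%N -> i \in I by rewrite mem_iota add0n ltnS.
pose X := [seq g i - d | i <- I] ++ [seq g i + d | i <- I].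
have [a [ea aX]] : exists a : aut, (forall x, e (a x) = t x) /\ fixes a [set` X].
  have [|a [ea aq]] := @generic_homogeneous t e [seq (x, x) | x <- X] tgen egen.
    split; last by move=> p p' /mapP[x _ ->] /mapP[y _ ->].
    move=> _ /mapP[x xX ->]; split=> //=; apply/esym.
    have [i ir xi] : exists2 i, (i <= r)%N & (g i - d <= x) && (x <= g i + d).
      move: xX; rewrite mem_cat => /orP[] /mapP[i].
      + by rewrite mem_iota add0n ltnS => ir ->; exists i => //; lra.
      + by rewrite mem_iota add0n ltnS => ir ->; exists i => //; lra.
    have [_ ei ti] := dP i ir; case/andP: xi => x1 x2.
    by rewrite ei// ti// etg.
  exists a; split=> // x xX; exact: (aq (x, x) (map_f (fun x => (x, x)) xX)).
(* For fixed i the points A i k increase from f i towards f i.+1. *)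
pose A i k := f i.+1 - (f i.+1 - f i) / k.+1%:R.
have A0 i : A i 0%N = f i by rewrite /A divr1 subKr.
have AS i k : A i k < A i k.+1.
  rewrite /A ltrD2l ltrN2 ltr_pM2l ?subr_gt0// ltf_pV2 ?posrE ?ltr0n//.
  by rewrite ltr_nat.
have Alt i k l : (k < l)%N -> A i k < A i l by exact: homo_ltn lt_trans (AS i) _ _.
have Ale i k l : (k <= l)%N -> A i k <= A i l.
  by rewrite leq_eqVlt => /predU1P[->//|/Alt/ltW].
have Af i k : A i k < f i.+1 by rewrite /A gtrDl oppr_lt0 divr_gt0 ?subr_gt0.
have fA i k : f i <= A i k by rewrite -A0 Ale.
pose Y k x := exists i, [/\ (i < r)%N, A i k.+1 <= x & x < A i k.+2].
pose Z x := [\/ x <= f 0%N, f r <= x | exists i k, (i < r)%N /\ x = A i k].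
have idx i j x : f i <= x -> x < f i.+1 -> f j <= x -> x < f j.+1 -> i = j.
  move=> fi fi' fj fj'; apply/eqP; rewrite eqn_leq; apply/andP; split.
    by rewrite leqNgt; apply/negP => /fle ji; move: fj'; rewrite ltNge (le_trans ji).
  by rewrite leqNgt; apply/negP => /fle ij; move: fi'; rewrite ltNge (le_trans ij).
have idxA i k l x : A i k <= x -> x < A i k.+1 -> A i l <= x -> x < A i l.+1 -> k = l.
  move=> h1 h2 h3 h4; apply/eqP; rewrite eqn_leq; apply/andP; split.
    by rewrite leqNgt; apply/negP => /(Ale i) lk; move: h4; rewrite ltNge (le_trans lk).
  by rewrite leqNgt; apply/negP => /(Ale i) lk; move: h2; rewrite ltNge (le_trans lk).
have YA i k l x : A i k <= x -> x < A i k.+1 -> Y l x -> k = l.+1.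
  move=> h1 h2 [j [_ h3 h4]]; have ij : i = j.
    apply: (idx _ _ x).
    - exact: le_trans (fA _ _) h1.
    - exact: lt_trans h2 (Af _ _).
    - exact: le_trans (fA _ _) h3.
    - exact: lt_trans h4 (Af _ _).
  by rewrite -ij in h3 h4; exact: idxA h1 h2 h3 h4.
have ZA i k : (i < r)%N -> Z (A i k) by move=> ir; constructor 3; exists i, k.
have Ysep k x y : x < y -> ~ (Y k x <-> Y k y) ->
    exists i, (i < r)%N /\ ((x < A i k.+1 /\ A i k.+1 <= y) \/
                           (x < A i k.+2 /\ A i k.+2 <= y)).
  move=> xy Yxy; apply: contrapT => nz; apply: Yxy.
  have nz1 i l : (i < r)%N -> l = k.+1 \/ l = k.+2 -> (A i l <= x) = (A i l <= y).
    move=> ir lk; apply/idP/idP => [h|h]; first exact: le_trans h (ltW xy).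
    rewrite leNgt; apply/negP => h'; apply: nz; exists i; split=> //.
    by case: lk => <-; [left|right].
  split=> -[i [ir h1 h2]]; exists i; split=> //.
  - by rewrite -nz1//; left.
  - by rewrite ltNge -nz1 -?ltNge//; right.
  - by rewrite nz1//; left.
  - by rewrite ltNge nz1 -?ltNge//; right.
have [k l x Yk [i [ir h1 h2]]|k x y xy /(Ysep _ _ _ xy)[i [ir [[h1 h2]|[h1 h2]]]]|k full] :=
    cover_matches_piece (Z := Z) (Y := Y) Gcov.
- by have [] := YA _ _ _ _ h1 h2 Yk.
- by exists (A i k.+1); split=> //; exact: ZA.
- by exists (A i k.+2); split=> //; exact: ZA.
(* The finite map that w has to realise: u i s is sent to v i s. *)
pose u i s := nth 0 [:: f i; A i k.+1; A i k.+2] s.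
pose v i s := nth 0 [:: g i; g i + d; g i.+1 - d] s.
pose q := [seq (u i s, v i s) | i <- I, s <- [:: 0; 1; 2]%N].
have gd i : (i <= r)%N -> g i + d < g i.+1 - d by move=> /dP[].
have qP p : p \in q -> exists i s, [/\ (i <= r)%N, (s < 3)%N & p = (u i s, v i s)].
  move=> /allpairsP[[i s] /= [iI sI ->]]; exists i, s; split=> //.
    by move: iI; rewrite mem_iota add0n ltnS.
  by move: sI; rewrite !inE => /or3P[] /eqP ->.
have uvP i s : (i <= r)%N -> (s < 3)%N ->
    [/\ f i <= u i s, u i s < f i.+1, g i <= v i s & v i s < g i.+1].
  move=> ir; have := gd i ir; have := Af i k.+1; have := fA i k.+1.
  have := AS i k.+1; have := Af i k.+2; have := fS i; have := gS i.
  by case: s => [|[|[|s]]]//; rewrite /u /v /= => *; split; lra.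
have qmono : {in q &, forall p p', (p.1 < p'.1) = (p.2 < p'.2)}.
  move=> p p' /qP[i [s [ir s3 ->]]] /qP[j [s' [jr s'3 ->]]] /=.
  have [u1 u2 v1 v2] := uvP i s ir s3; have [u1' u2' v1' v2'] := uvP j s' jr s'3.
  have [ij|ji|ij] := ltngtP i j.
  - rewrite (lt_le_trans u2 (le_trans (fle _ _ ij) u1')).
    by rewrite (lt_le_trans v2 (le_trans (gle _ _ ij) v1')).
  - rewrite ltNge (ltW (lt_le_trans u2' (le_trans (fle _ _ ji) u1))).
    by rewrite ltNge (ltW (lt_le_trans v2' (le_trans (gle _ _ ji) v1))).
  - rewrite -{}ij in u1' u2' v1' v2' *.
    have h1 := gd i ir; have h2 : f i < A i k.+1 by rewrite -A0 Alt.
    have h3 := AS i k.+1; have h4 : f i < A i k.+2 := lt_trans h2 h3.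
    have h5 : g i < g i.+1 - d by lra.
    have h6 : g i < g i + d by lra.
    case: s s3 {u1 u2 v1 v2} => [|[|[|s]]]// _;
    case: s' s'3 {u1' u2' v1' v2'} => [|[|[|s']]]// _;
    by rewrite /u /v /= ?ltxx//; lra.
have [c cq] := aut_extend qmono.
have inq i s : (i <= r)%N -> (s < 3)%N -> (u i s, v i s) \in q.
  move=> ir s3; apply/allpairsP; exists (i, s); split=> //=; first exact: Ir.
  by case: s s3 => [|[|[|]]].
have [|w [Vw VwV _ wq]] := FP c [seq p.1 | p <- q].
  move=> z /Ff[i /[dup] ir0 /andP[i0 ir] ->].
  by rewrite (cq _ (inq i 0%N (ltnW ir) isT))/= /v/= gf.
have wuv i s : (i <= r)%N -> (s < 3)%N -> w (u i s) = v i s.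
  move=> ir s3; have uq := inq i s ir s3.
  by rewrite wq ?(cq _ uq)//; apply/mapP; exists (u i s, v i s).
have w0 i : (i <= r)%N -> w (f i) = g i by move=> ir; exact: (wuv i 0%N).
have w1 i : (i <= r)%N -> w (A i k.+1) = g i + d by move=> ir; exact: (wuv i 1%N).
have w2 i : (i <= r)%N -> w (A i k.+2) = g i.+1 - d by move=> ir; exact: (wuv i 2%N).
have aX1 i : (i <= r)%N -> a (g i + d) = g i + d.
  move=> ir; apply: aX; rewrite /= mem_cat.
  by rewrite (map_f (fun i => g i + d) (Ir i ir)) orbT.
have aX2 i : (i < r)%N -> a (g i.+1 - d) = g i.+1 - d.
  move=> ir; apply: aX; rewrite /= mem_cat.
  by rewrite (map_f (fun i => g i - d) (Ir i.+1 ir)).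
(* Stretching by w turns a' on Y k into a between the short pieces. *)
pose a' := autM (autV w) (autM a w).
have a'1 i : (i < r)%N -> a' (A i k.+1) = A i k.+1.
  by move=> ir; rewrite !autME w1 ?aX1 -?w1 ?autKV// ltnW.
have a'2 i : (i < r)%N -> a' (A i k.+2) = A i k.+2.
  by move=> ir; rewrite !autME w2 ?aX2 -?w2 ?autKV// ltnW.
have [x y xy cxy|b' b'E] :=
    @glue_aut bool (fun x => `[<Y k x>]) (fun c => if c then a' else aut1).
  have [|i [ir h]] := Ysep k x y xy.
    by move=> Yxy; apply: cxy; apply/asbool_equiv_eq.
  have [z [xz zy az]] : exists z, [/\ x < z, z <= y & a' z = z].
    by case: h => -[h1 h2]; [exists (A i k.+1)|exists (A i k.+2)]; split=> //;
       [exact: a'1|exact: a'2].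
  by exists z, z; split=> //; [case: asboolP|case: asboolP].
have b'Z : fixes b' Z.
  move=> x Zx; rewrite b'E; case: asboolP => // Yx.
  have [i [ir h1 h2]] := Yx.
  case: Zx => [x0|rx|[j [l [jr xE]]]].
  - have : f 0%N < x.
      apply: le_lt_trans (fle 0%N i isT) (lt_le_trans _ h1).
      by rewrite -[f i]A0 Alt.
    by rewrite ltNge x0.
  - by move: (lt_trans h2 (Af _ _)); rewrite ltNge (le_trans _ rx)// fle.
  - have lk : l = k.+1 by apply: (YA j l k x) => //; rewrite xE.
    by rewrite xE lk a'1.
have [b [Vb bZ bY]] := full b' b'Z.
exists w, b; split=> // x.
have Wx : w (autV w x) = x by rewrite autVK.
have [xlb|lbx] := leP x lb.
  rewrite bZ ?Wx ?etlb//; constructor 1.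
  by rewrite -(aut_le w) Wx w0// ltnW// ltnW.
have [xub|ubx] := ltP x ub; last first.
  rewrite bZ ?Wx ?etub//; constructor 2.
  by rewrite -(aut_le w) Wx w0// gr.
have [||i [ir gx xg]] := @find_interval g r x; [exact: ltW|by rewrite gr|].
have [dg ei ti] := dP i (ltnW ir); have [_ ei' ti'] := dP i.+1 ir.
have bw y : Z (autV w y) -> forall z, (y <= z) = (y <= w (b (autV w z))).
  move=> Zy z; have yE : w (b (autV w y)) = y by rewrite bZ// autVK.
  by rewrite -[in RHS]yE !aut_le.
have bw' y : Z (autV w y) -> forall z, (z <= y) = (w (b (autV w z)) <= y).
  move=> Zy z; have yE : w (b (autV w y)) = y by rewrite bZ// autVK.
  by rewrite -[in RHS]yE !aut_le.
have Zf j : (j <= r)%N -> Z (f j).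
  rewrite leq_eqVlt => /predU1P[->|jr]; first by constructor 2.
  by rewrite -A0; exact: ZA.
have Zg j : (j <= r)%N -> Z (autV w (g j)).
  by move=> jr; rewrite -w0// autKV; exact: Zf.
have Z1 : Z (autV w (g i + d)) by rewrite -(w1 i (ltnW ir)) autKV; exact: ZA.
have Z2 : Z (autV w (g i.+1 - d)) by rewrite -(w2 i (ltnW ir)) autKV; exact: ZA.
have [xd|dx] := leP x (g i + d).
  rewrite ei; last by rewrite -bw'.
    by rewrite ti ?etg ?(ltnW ir)//; lra.
  by apply: (@le_trans _ _ (g i)); [lra|rewrite -bw//; exact: Zg (ltnW ir)].
have [xd|dx'] := ltP x (g i.+1 - d); last first.
  rewrite ei'; last first.
  - by apply: (@le_trans _ _ (g i.+1)); [rewrite -bw' ?ltW//; exact: Zg|lra].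
  - by rewrite -bw.
  by rewrite ti' ?etg//; lra.
rewrite bY; last first.
  exists i; split=> //; first by rewrite -(aut_le w) Wx w1 ?ltW// ltnW.
  by rewrite -(aut_lt w) Wx w2// ltnW.
rewrite b'E asboolT; last first.
  exists i; split=> //; first by rewrite -(aut_le w) Wx w1 ?ltW// ltnW.
  by rewrite -(aut_lt w) Wx w2// ltnW.
by rewrite !autME !autVK ea.
Qed.

Lemma nat_above (p : rat) : exists n : nat, p < n%:R.
Proof.
exists (Num.truncn p).+1; exact: truncnS_gt.
Qed.

(** * Neighbourhoods contain cylinders *)

Lemma int_ladder (x y : nat -> rat) :
  (forall j, x j + 1 < x j.+1) -> (forall j, y j.+1 < y j - 1) -> y 0%N < x 0%N ->
  exists z : int -> rat, [/\ forall j : nat, z j = x j, forall j, z (Negz j) = y j,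
    forall i j, i < j -> z i < z j &
    forall q, exists i, z i <= q < z (i + 1)].
Proof.
move=> xS yS yx.
pose z i := match i with Posz j => x j | Negz j => y j end.
have zS i : z i < z (i + 1).
  case: i => [j|[|j]].
  - have -> : Posz j + 1 = j.+1 by lia.
    by have := xS j; rewrite /=; lra.
  - by have -> : Negz 0 + 1 = 0 :> int by [].
  - have -> : Negz j.+1 + 1 = Negz j by rewrite !NegzE; lia.
    by have := yS j; rewrite /=; lra.
have zlt i j : i < j -> z i < z j.
  move=> ij; have [n ->] : exists n : nat, j = i + n.+1.
    by exists (`|j - i|%N.-1); lia.
  elim: n => [|n IH]; first exact: zS.
  by apply: lt_trans IH _; rewrite (_ : i + n.+2 = i + n.+1 + 1)//; lia.
exists z; split=> // q.
have [a [qa]] : exists a : nat, q < x a.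
  have [n qn] := nat_above (q - x 0%N); exists n.
  have : x 0%N + n%:R <= x n.
    elim: n {qn} => [|n IH]; first by rewrite addr0.
    by rewrite -natr1; have := xS n; lra.
  by lra.
have [b yb] : exists b : nat, y b <= q.
  have [n qn] := nat_above (y 0%N - q); exists n.
  have : y n <= y 0%N - n%:R.
    elim: n {qn} => [|n IH]; first by rewrite subr0.
    by rewrite -natr1; have := yS n; lra.
  by lra.
have [||k [_ k1 k2]] := @find_interval (fun k : nat => z (Negz b + k)) (b.+1 + a) q.
- by rewrite addr0.
- by rewrite (_ : Negz b + _ = a)//; rewrite NegzE; lia.
exists (Negz b + k); rewrite k1/=.
by rewrite (_ : Negz b + k + 1 = Negz b + k.+1)//; lia.
Qed.

(** The points z i where e and t agree cut the line into blocks, with level 0 for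
    the block containing lb0 and ub0, so [match_deep_levels] makes e agree with
    t far out on both sides without changing it between lb0 and ub0. *)
Lemma tail_correction (R : realType) B v (e t : MQ) lb0 ub0 :
  semigroup_base B -> B v MQ_id -> generic e -> generic t ->
  agree_cofinally e t -> lb0 < ub0 ->
  exists (b : aut) (lb ub : rat), [/\ lb < lb0, ub0 < ub, B v b &
    [/\ forall x, lb0 <= x -> x <= ub0 -> b x = x,
        forall x, x <= lb -> e (b x) = t x &
        forall x, ub <= x -> e (b x) = t x]].
Proof.
move=> BB Bv egen tgen et lu0.
have [x [x0P xS]] : exists x : nat -> rat, (forall j, e (x j) = t (x j) /\ ub0 < x j) /\
    (forall j, x j + 1 < x j.+1).
  have step (n : nat) (c : rat) : e c = t c /\ ub0 < c ->
      exists2 c', e c' = t c' /\ ub0 < c' & c + 1 < c'.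
    move=> [_ uc]; have [[c' cc' ec'] _] := et (c + 1).
    by exists c' => //; split=> //; lra.
  have [[c0 uc0 ec0] _] := et ub0.
  have [x [_ xok xS]] := dependent_chain step (conj ec0 uc0).
  by exists x.
have [y [y0P yS]] : exists y : nat -> rat, (forall j, e (y j) = t (y j) /\ y j < lb0) /\
    (forall j, y j.+1 < y j - 1).
  have step (n : nat) (c : rat) : e c = t c /\ c < lb0 ->
      exists2 c', e c' = t c' /\ c' < lb0 & c' < c - 1.
    move=> [_ uc]; have [_ [c' cc' ec']] := et (c - 1).
    by exists c' => //; split=> //; lra.
  have [_ [c0 uc0 ec0]] := et lb0.
  have [y [_ yok yS]] := dependent_chain step (conj ec0 uc0).
  by exists y.
have yx : y 0%N < x 0%N by have [_] := y0P 0%N; have [_] := x0P 0%N; lra.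
have [z [zx zy zlt /choice[idx idxP]]] := int_ladder xS yS yx.
have zle i j : i <= j -> z i <= z j.
  by rewrite le_eqVlt => /predU1P[->//|/zlt/ltW].
have ez i : e (z i) = t (z i).
  by case: i => j; rewrite ?zx ?zy; [have [] := x0P j|have [] := y0P j].
have idxE i q : z i <= q -> q < z (i + 1) -> idx q = i.
  have /andP[q1 q2] := idxP q => iq qi.
  have [h|h|//] := ltgtP (idx q) i.
    have : z (idx q + 1) <= z i by apply: zle; lia.
    by move=> h'; move: q2; rewrite ltNge (le_trans h' iq).
  have : z (i + 1) <= z (idx q) by apply: zle; lia.
  by move=> h'; move: qi; rewrite ltNge (le_trans h' q1).
have idx_z i : idx (z i) = i by apply: idxE => //; apply: zlt; lia.
have idx_mono p q : p <= q -> idx p <= idx q.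
  move=> pq; rewrite leNgt; apply/negP => h.
  have /andP[p1 _] := idxP p; have /andP[_ q2] := idxP q.
  have : z (idx q + 1) <= z (idx p) by apply: zle; lia.
  by move=> h'; move: q2; rewrite ltNge (le_trans h' (le_trans p1 pq)).
pose lo q := z (idx q); pose hi q := z (idx q + 1); pose lev q := absz (idx q + 1).
have P : block_partition lo hi lev.
  move=> q; have /andP[q1 q2] := idxP q; split=> // p p1 p2.
  by rewrite /lo /hi /lev (idxE _ _ p1 p2).
have [n nP] := match_deep_levels R BB Bv P.
have /choice[a aP] : forall i : int, exists a : aut,
    [/\ a (z i) = z i, a (z (i + 1)) = z (i + 1) &
    if (n <= absz (i + 1)%R)%N then forall q, e (a q) = t q else a = aut1].
  move=> i; case: (leqP n (absz (i + 1))) => _; last by exists aut1.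
  have [|a [ea aq]] := @generic_homogeneous t e
      [:: (z i, z i); (z (i + 1), z (i + 1))] tgen egen.
    split=> [p|p p']; rewrite !inE.
      by move=> /orP[] /eqP ->; split=> //=; rewrite ez.
    by move=> /orP[] /eqP -> /orP[] /eqP ->.
  exists a; split=> //.
    by apply: (aq (z i, z i)); rewrite mem_head.
  by apply: (aq (z (i + 1), z (i + 1))); rewrite !inE eqxx orbT.
have [p q pq ipq|d dE] := @glue_aut _ idx a.
  have lt : idx p < idx q.
    by rewrite lt_neqAle idx_mono ?ltW// andbT; apply/eqP.
  have /andP[_ p2] := idxP p; have /andP[q1 _] := idxP q.
  exists (z (idx p + 1)), (z (idx q)); split=> //.
  - by apply: zle; lia.
  - by have [] := aP (idx p).
  - by have [] := aP (idx q).
have [|q qn|b [Bb blo b0 bd]] := nP d.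
- by move=> q; rewrite dE /lo idx_z; have [] := aP (idx q).
- by rewrite dE; have [_ _] := aP (idx q); rewrite leqNgt qn => ->.
exists b, (y n), (x n); split=> //.
- by have [] := y0P n.
- by have [] := x0P n.
have et_lev q : (n <= lev q)%N -> e (b q) = t q.
  move=> nq; rewrite bd// dE; have [_ _] := aP (idx q).
  by rewrite -/(lev q) nq; exact.
split=> [q q1 q2|q qy|q xq].
- apply: b0; rewrite /lev (idxE (Negz 0))//.
    by rewrite zy; apply/ltW/(lt_le_trans _ q1); have [] := y0P 0%N.
  by rewrite (zx 0%N); apply: (le_lt_trans q2); have [] := x0P 0%N.
- apply: et_lev; rewrite /lev.
  have : idx q <= Negz n by rewrite -(idx_z (Negz n)) idx_mono// zy.
  by rewrite NegzE; lia.
- apply: et_lev; rewrite /lev.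
  have : n%:Z <= idx q by rewrite -(idx_z n) idx_mono// zx.
  by lia.
Qed.

Lemma common_denominator (F : seq rat) : exists2 D : nat, (0 < D)%N &
  forall z, z \in F -> exists m : int, z * D%:R = m%:~R.
Proof.
elim: F => [|x F [D D0 DF]]; first by exists 1%N.
exists (absz (denq x) * D)%N; first by rewrite muln_gt0 D0 absz_gt0 denq_neq0.
have dx : (absz (denq x))%:R = (denq x)%:~R :> rat by rewrite -[in RHS]absz_denq.
move=> z; rewrite inE natrM => /predU1P[->|/DF[m zm]].
  exists (numq x * D); rewrite mulrA dx -{1}(divq_num_den x) intrM.
  by rewrite divfK// intr_eq0 denq_neq0.
by exists (denq x * m); rewrite mulrCA zm dx intrM.
Qed.

(** An arithmetic progression: the multiples of 1 / D, for a common denominator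
    D of F. *)
Lemma grid_contains (F : seq rat) : exists (f : nat -> rat) (r : nat),
  [/\ (1 < r)%N, forall i, f i < f i.+1 &
    forall z, z \in F -> exists2 i, (0 < i < r)%N & z = f i].
Proof.
have [D D0 DF] := common_denominator F.
have [M MF] : exists M : nat, forall z, z \in F -> `|z * D%:R| < M%:R.
  have [p pF] := seq_ub [seq `|z * D%:R| | z <- F].
  have [M pM] := nat_above p; exists M => z zF; apply: lt_trans pM.
  by apply: pF; exact: (map_f (fun z => `|z * D%:R|)).
have DD : 0 < D%:R :> rat by rewrite ltr0n.
exists (fun i => (i%:R - M%:R) / D%:R), (M.*2 + 2)%N; split.
- by rewrite addn2.
- by move=> i; rewrite ltr_pM2r ?invr_gt0// ltrD2r ltr_nat.
move=> z zF; have [m zm] := DF z zF; have := MF z zF.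
rewrite zm -intr_norm -[M%:R]/(M%:~R) ltr_int => mM.
exists (absz (m + M%:Z)); first by lia.
have -> : (absz (m + M%:Z))%:R = m%:~R + M%:R :> rat.
  rewrite -[M%:R]/(M%:Z%:~R) -intrD -[LHS]/((absz (m + M%:Z))%:Z%:~R).
  by congr (_%:~R); lia.
by rewrite addrK -zm mulfK// gt_eqF.
Qed.

Lemma generic_comp_aut (e : MQ) (b : aut) : generic e -> generic (MQ_comp e b).
Proof.
move=> [esurj eop]; split=> [p|x].
  by have [y ey] := esurj p; exists (autV b y); rewrite -[LHS]/(e (b _)) autVK.
have [[y1 y1x ey1] [y2 xy2 ey2]] := eop (b x).
split.
  exists (autV b y1); first by rewrite -(aut_lt b) autVK.
  by rewrite -[LHS]/(e (b _)) autVK.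
exists (autV b y2); first by rewrite -(aut_lt b) autVK.
by rewrite -[LHS]/(e (b _)) autVK.
Qed.

Lemma base_mul4 B k f : semigroup_base B -> B k f ->
  exists i j, [/\ B i f, B j MQ_id & forall g b1 b2 b3 b4,
    B i g -> B j b1 -> B j b2 -> B j b3 -> B j b4 ->
    B k (MQ_comp (MQ_comp (MQ_comp (MQ_comp g b1) b2) b3) b4)].
Proof.
move=> BB Bf.
have [i4 [j4 [Bi4 Bj4 h4]]] := base_mul BB Bf.
have [i3 [j3 [Bi3 Bj3 h3]]] := base_mul BB Bi4.
have [i2 [j2 [Bi2 Bj2 h2]]] := base_mul BB Bi3.
have [i1 [j1 [Bi1 Bj1 h1]]] := base_mul BB Bi2.
have [j12 B12 P12] := base_meet BB Bj1 Bj2.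
have [j34 B34 P34] := base_meet BB Bj3 Bj4.
have [j Bj P] := base_meet BB B12 B34.
exists i1, j; split=> // g b1 b2 b3 b4 Bg.
move=> /P[/P12[+ _] _] /P[/P12[_ +] _] /P[_ /P34[+ _]] /P[_ /P34[_ +]].
by move=> Bb1 Bb2 Bb3 Bb4; apply/h4/Bb4/h3/Bb3/h2/Bb2/h1.
Qed.

(** Choose neighbourhoods of s and of the identity whose product, with four
    factors of the latter kind, stays in a neighbourhood B j of s whose closure
    lies in B k. Let F contain the set whose stabiliser is approximated, and let
    t agree with s on F. Arbitrarily close to t there is a generic h that agrees
    with t on F and cofinally with a generic e close to s; the two corrections
    carry e to h, which shows that h lies in B j. So t is in the closure of B j. *)
Lemma base_sub_pointwise (R : realType) B k s : semigroup_base B -> B k s ->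
  exists F : seq rat, forall t : MQ, {in F, t =1 s} -> B k t.
Proof.
move=> BB Bs.
have [j Bj jk] := base_regular BB Bs.
have [i [v [Bi Bv iv]]] := base_mul4 BB Bj.
have [G Gcov] := base_cover BB Bv.
have [F0 FP] := cover_approximates Gcov.
have [f [r [r1 fS Ff]]] := grid_contains F0.
have flt a b : (a < b)%N -> f a < f b by exact: homo_ltn lt_trans fS _ _.
pose F := [seq f a | a <- iota 1 r.-1].
have inF a : (0 < a < r)%N -> f a \in F.
  move=> /andP[a0 ar]; apply: map_f; rewrite mem_iota a0/= add1n prednK// ltnW//.
exists F => t tF; apply: jk => l Bl.
have [i' Bi' i'P] := base_agree s F BB.
have [i1 Bi1 i1P] := base_meet BB Bi Bi'.
have [e /i1P[Be /i'P eF] egen] := generic_dense R BB Bi1.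
have [l' Bl' l'P] := base_agree t F BB.
have [l1 Bl1 l1P] := base_meet BB Bl Bl'.
have [h [/l1P[Bh /l'P hF] hgen eh]] := agree_cofinally_dense R BB egen Bl1.
exists h => //.
have ehF a : (0 < a < r)%N -> e (f a) = h (f a).
  by move=> /inF aF; rewrite eF// hF// tF.
have [b1 [lb [ub [lbf fub Bb1 [b1id b1lb b1ub]]]]] :=
  tail_correction R BB Bv egen hgen eh (flt 0%N r (ltnW r1)).
have [|||||w [b [Bw BwV Bb wb]]] := compact_correction Gcov FP r1 fS Ff
    (generic_comp_aut b1 egen) hgen (lb := lb) (ub := ub).
- exact: lt_trans (fS 0%N).
- by apply: lt_trans fub; apply: flt; rewrite ltn_predL ltnW.
- move=> a ar; rewrite -[LHS]/(e (b1 (f a))) b1id ?ehF//.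
    by apply/ltW/flt; case/andP: ar.
  by apply/ltW/flt; case/andP: ar.
- exact: b1lb.
- exact: b1ub.
have -> : h = MQ_comp (MQ_comp (MQ_comp (MQ_comp e b1) w) b) (autV w).
  by apply: MQ_ext => x; rewrite -wb.
exact: iv.
Qed.

(** * The pointwise topology *)

Lemma pointwise_open (O : set MQ) : opens pointwise_topology O <->
  forall f, O f -> exists F : seq rat, forall g : MQ, {in F, g =1 f} -> O g.
Proof.
split.
  move=> [A Aop <-] f Af.
  pose cyl (F : seq rat) : set {ptws rat -> discrete_topology rat} :=
    [set h : {ptws rat -> discrete_topology rat} |
      forall x, x \in F -> h x = val f x :> rat].
  pose Fl : set_system {ptws rat -> discrete_topology rat} :=
    filter_from [set: seq rat] cyl.
  have FlF : Filter Fl.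
    apply: filter_from_filter; first by exists [::].
    move=> F F' _ _; exists (F ++ F') => // h hF.
    by split=> x xF; apply: hF; rewrite mem_cat xF ?orbT.
  have Flf : Fl --> (MQ_incl f : {ptws rat -> discrete_topology rat}).
    apply/cvg_sup => x U.
    rewrite /= (@nbhsE (initial_topology
      (fun h : rat -> discrete_topology rat => h x))) => -[V [[W Wop <-] Wf] VU].
    exists [:: x] => // h hx; apply: VU => /=.
    by rewrite hx ?mem_head.
  have : Fl A by apply: Flf; exact: open_nbhs_nbhs.
  by move=> [F _ FA]; exists F => g gF; exact: FA.
move=> OF.
pose cyl (p : MQ * seq rat) : set {ptws rat -> discrete_topology rat} :=
  [set h : {ptws rat -> discrete_topology rat} |
    forall x, x \in p.2 -> h x = val p.1 x :> rat].
have cyl_open p : open (cyl p).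
  case: p => f; elim=> [|x F IH].
    rewrite (_ : cyl _ = setT); first exact: openT.
    by apply/seteqP; split.
  rewrite (_ : cyl _ = cyl (f, F) `&` (@proj rat (fun=> discrete_topology rat) x @^-1` [set val f x])).
    apply: openI => //; apply: open_comp; last exact: discrete_open.
    by move=> h _; exact: proj_continuous.
  apply/seteqP; split=> h /=.
    move=> hF; split; last by rewrite /proj hF// mem_head.
    by move=> y yF; apply: hF; rewrite inE yF orbT.
  by move=> [hF hx] y; rewrite inE => /predU1P[->//|]; exact: hF.
exists (\bigcup_(p in [set p : MQ * seq rat |
    forall g : MQ, {in p.2, g =1 p.1} -> O g]) cyl p).
  exact: bigcup_open.
apply/seteqP; split=> [g [p /= pO gp]|f Of]; first exact: pO.
by have [F FO] := OF f Of; exists (f, F).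
Qed.

Definition cylinder (f : MQ) (F : seq rat) : set MQ := [set g : MQ | {in F, g =1 f}].

Lemma cylinder_open f F : opens pointwise_topology (cylinder f F).
Proof.
by apply/pointwise_open => g gF; exists F => h hg x xF; rewrite hg// gF.
Qed.

Lemma pointwise_second_countable : @second_countable (top_space pointwise_topology).
Proof.
pose cyl (q : seq (rat * rat)) : set MQ := [set f : MQ | forall p, p \in q -> f p.1 = p.2].
exists [set cyl q | q in setT]; first exact: card_le_trans (card_image_le _ _) (countableP _).
split=> [_ [q _ <-]|f A].
  apply/pointwise_open => f fq; exists (unzip1 q) => g gf p pq.
  by rewrite gf; [exact: fq|exact: map_f].
rewrite nbhsE => -[ O [/pointwise_open Oop Of] OA].
have [F FO] := Oop f Of.
exists (cyl [seq (x, MQ_fun f x) | x <- F]).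
  split; first by exists [seq (x, MQ_fun f x) | x <- F].
  by move=> _ /mapP[x xF ->].
move=> g gF; apply/OA/FO => x xF.
by have := gF (x, MQ_fun f x) (map_f _ xF).
Qed.

Lemma pointwise_semigroup : semigroup_topology MQ_comp pointwise_topology.
Proof.
move=> [f g] A; rewrite /= (@nbhsE (top_space pointwise_topology)) => -[ O [/pointwise_open Oop Ofg] OA].
have [F FO] := Oop _ Ofg.
exists (cylinder f (map (MQ_fun g) F), cylinder g F) => /=.
  by split; apply: (@open_nbhs_nbhs (top_space pointwise_topology)); split=> //;
    exact: cylinder_open.
move=> [f' g'] /= [f'f g'g]; apply/OA/FO => x xF.
rewrite -[LHS]/(MQ_fun f' (MQ_fun g' x)) -[RHS]/(MQ_fun f (MQ_fun g x)).
rewrite g'g// f'f//.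
exact: map_f.
Qed.

(** The limit of a sequence of conditions (f, F), each standing for the cylinder
    of the maps that agree with f on F, is again increasing. *)
Lemma pointwise_baire : baire_space (top_space pointwise_topology).
Proof.
move=> U UP; move=> O [f0 Of0] /pointwise_open/(_ f0 Of0)[F0 F0O].
pose R n (c c' : MQ * seq rat) := [/\ {in c.2, c'.1 =1 c.1},
  {subset c.2 <= c'.2}, enum_rat n \in c'.2 & cylinder c'.1 c'.2 `<=` U n].
have step n c : True -> exists2 c', True & R n c c'.
  move=> _; have [/pointwise_open Uop Ud] := UP n.
  have [||g [gc Ug]] := Ud (cylinder c.1 c.2).
  - by exists c.1.
  - exact: cylinder_open.
  have [F FU] := Uop g Ug.
  exists (g, enum_rat n :: c.2 ++ F) => //; split=> //=.
  - by move=> x xc; rewrite inE mem_cat xc orbT.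
  - exact: mem_head.
  - by move=> h hg; apply: FU => x xF; rewrite hg// inE mem_cat xF !orbT.
have [Q [Q0 _ QR]] := @dependent_chain _ (fun=> True) R step (f0, F0) I.
have Qext m n : (m <= n)%N ->
    {in (Q m).2, (Q n).1 =1 (Q m).1} /\ {subset (Q m).2 <= (Q n).2}.
  elim: n => [|n IH]; first by rewrite leqn0 => /eqP ->; split.
  rewrite leq_eqVlt => /predU1P[->|mn]; first by split.
  have [mn1 mn2] := IH mn; have [nn1 nn2 _ _] := QR n.
  by split=> x xm; [rewrite nn1 ?mn1// mn2|rewrite nn2// mn2].
have xQ x : x \in (Q (pickle x).+1).2.
  by have [_ _ + _] := QR (pickle x); rewrite enum_ratK.
pose a x := (Q (pickle x).+1).1 x.
have aE n x : x \in (Q n).2 -> a x = (Q n).1 x.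
  move=> xn.
  have [/(_ x xn) <- _] := Qext _ _ (leq_maxl n (pickle x).+1).
  by have [/(_ x (xQ x)) -> _] := Qext _ _ (leq_maxr n (pickle x).+1).
have ah : {homo a : x y / x <= y}.
  move=> x y xy; pose m := maxn (pickle x).+1 (pickle y).+1.
  rewrite (aE m) ?(aE m y) ?MQ_le//.
    by apply: (Qext _ _ (leq_maxr _ _)).2; exact: xQ.
  by apply: (Qext _ _ (leq_maxl _ _)).2; exact: xQ.
exists (MQ_of ah); split.
  by apply: F0O => x xF; rewrite -[LHS]/(a x) (aE 0%N) Q0.
by move=> n _; have [_ _ _] := QR n; apply => x xn; exact: aE.
Qed.

(** The distance is 1 / (n + 1) where n is the first index, in a fixed
    enumeration of the rationals, at which two maps differ. *)
Definition first_difference (f g : MQ)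
    (ex : exists n, f (enum_rat n) != g (enum_rat n)) : nat := ex_minn ex.

Section PointwiseDistance.
Variable R : realType.

Definition pointwise_dist (f g : MQ) : R :=
  if pselect (exists n, f (enum_rat n) != g (enum_rat n)) is left ex
  then (first_difference ex).+1%:R^-1 else 0.

Lemma pointwise_dist_ge (f g : MQ) n : f (enum_rat n) != g (enum_rat n) ->
  n.+1%:R^-1 <= pointwise_dist f g.
Proof.
move=> fgn; rewrite /pointwise_dist; case: pselect => [ex|nex]; last first.
  by exfalso; apply: nex; exists n.
rewrite /first_difference; case: ex_minnP => m _ mmin.
by rewrite lef_pV2 ?posrE ?ltr0n// ler_nat ltnS mmin.
Qed.

Lemma pointwise_distP (f g : MQ) : pointwise_dist f g = 0 /\ f = g \/
  exists2 n, f (enum_rat n) != g (enum_rat n) & pointwise_dist f g = n.+1%:R^-1.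
Proof.
rewrite /pointwise_dist; case: pselect => [ex|nex].
  by right; exists (first_difference ex) => //; rewrite /first_difference; case: ex_minnP.
left; split=> //; apply: MQ_ext => x; apply/eqP; apply: contrapT => /negP fg.
by apply: nex; exists (pickle x); rewrite enum_ratK.
Qed.

Lemma pointwise_dist_ge0 f g : 0 <= pointwise_dist f g.
Proof. by case: (pointwise_distP f g) => [[-> _]//|[n _ ->]]. Qed.

Lemma pointwise_distxx f : pointwise_dist f f = 0.
Proof. by case: (pointwise_distP f f) => [[]//|[n]]; rewrite eqxx. Qed.

Lemma pointwise_dist_eq0 f g : pointwise_dist f g = 0 -> f = g.
Proof.
case: (pointwise_distP f g) => [[]//|[n _ ->]] /eqP.
by rewrite invr_eq0 pnatr_eq0.
Qed.

Lemma pointwise_dist_sym f g : pointwise_dist f g = pointwise_dist g f.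
Proof.
wlog suff H : f g / pointwise_dist f g <= pointwise_dist g f.
  by apply: le_anti; rewrite !H.
case: (pointwise_distP f g) => [[-> _]|[n fgn ->]]; first exact: pointwise_dist_ge0.
by apply: pointwise_dist_ge; rewrite eq_sym.
Qed.

Lemma pointwise_dist_triangle g f h :
  pointwise_dist f h <= pointwise_dist f g + pointwise_dist g h.
Proof.
case: (pointwise_distP f h) => [[-> _]|[n fhn ->]].
  by rewrite addr_ge0 ?pointwise_dist_ge0.
have [fgn|fgn] := eqVneq (f (enum_rat n)) (g (enum_rat n)).
  apply: ler_wpDl; first exact: pointwise_dist_ge0.
  by apply: pointwise_dist_ge; rewrite -fgn.
by apply: ler_wpDr; [exact: pointwise_dist_ge0|exact: pointwise_dist_ge].
Qed.

(** A copy of MQ, so that the metric does not become the canonical structure of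
    MQ itself. *)
Definition pointwise_metric_space : Type := MQ.

HB.instance Definition _ := Choice.on pointwise_metric_space.

HB.instance Definition _ := @isMetric.Build R pointwise_metric_space
  pointwise_dist pointwise_distxx pointwise_dist_eq0 pointwise_dist_sym
  pointwise_dist_triangle.

End PointwiseDistance.

Lemma pointwise_metrisable (R : realType) :
  metrisable R (top_space pointwise_topology).
Proof.
pose T : metricType R := pointwise_metric_space.
exists (Metric.class T); rewrite -[LHS]/(@open T).
apply/seteqP; split=> O.
  rewrite openE => Oop; apply/pointwise_open => f Of.
  have /nbhs_ballP[e /= e0 eO] := Oop f Of.
  have [n ne] : exists n, n.+1%:R^-1 < e.
    exists (Num.bound e^-1); rewrite invf_plt ?posrE ?ltr0n//.
    apply: lt_trans (archi_boundP _) _; first by rewrite invr_ge0 ltW.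
    by rewrite ltr_nat ltnSn.
  exists [seq enum_rat i | i <- iota 0 n.+1] => g gf; apply: eO.
  rewrite ballEmdist/= -[X in X < _]/(pointwise_dist R f g).
  case: (pointwise_distP R f g) => [[-> _]//|[m fgm ->]].
  apply: le_lt_trans ne; rewrite lef_pV2 ?posrE ?ltr0n// ler_nat ltnS.
  rewrite leqNgt; apply/negP => mn; move: fgm; rewrite gf ?eqxx//.
  by apply/mapP; exists m; rewrite // mem_iota add0n ltnS (ltnW mn).
move=> /pointwise_open Oop; rewrite openE => f Of.
have [F FO] := Oop f Of; apply/nbhs_ballP.
have [n nF] : exists n, forall x, x \in F -> (pickle x <= n)%N.
  elim: F {FO} => [|x F [n nF]]; first by exists 0%N.
  exists (maxn n (pickle x)) => y; rewrite inE leq_max => /predU1P[->|/nF -> //].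
  by rewrite leqnn orbT.
exists n.+1%:R^-1 => [|g]; first by rewrite /= invr_gt0.
rewrite ballEmdist/= -[X in X < _]/(pointwise_dist R f g) => fg.
apply: FO => x xF; apply/eqP; apply: contrapT => /negP; rewrite eq_sym => fgx.
move: fg; rewrite ltNge => /negP; apply.
apply: (@le_trans _ _ (pickle x).+1%:R^-1).
  by rewrite lef_pV2 ?posrE ?ltr0n// ler_nat ltnS nF.
by apply: pointwise_dist_ge; rewrite enum_ratK.
Qed.

(** * From a topology to its countable base *)

Definition base_of (tau : Topological MQ) (B : nat -> set MQ) :=
  (forall n, opens tau (B n)) /\
  (forall O f, opens tau O -> O f -> exists2 n, B n f & B n `<=` O).

Lemma second_countable_base (tau : Topological MQ) :
  @second_countable (top_space tau) -> exists B, base_of tau B.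
Proof.
move=> [S /countable_injP[i i_inj] [Sop Sbase]].
exists (fun n => \bigcup_(U in [set U | S U /\ i U = n]) U); split.
  by move=> n; apply: bigcup_open => U [SU _]; exact: Sop.
move=> O f Oop Of.
have [U [SU Uf] UO] := Sbase f O (@open_nbhs_nbhs (top_space tau) f O (conj Oop Of)).
exists (i U); first by exists U.
move=> g [V [SV iV] Vg]; apply: UO.
by rewrite -(i_inj V U)// inE.
Qed.

Lemma comp_open (tau : Topological MQ) B O f g : base_of tau B ->
  semigroup_topology MQ_comp tau -> opens tau O -> O (MQ_comp f g) ->
  exists i j, [/\ B i f, B j g &
    forall f' g', B i f' -> B j g' -> O (MQ_comp f' g')].
Proof.
move=> [Bop Bbase] comp_cont Oop Ofg.
have [[P Q] /= [nP nQ] PQ] := comp_cont (f, g) O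
  (@open_nbhs_nbhs (top_space tau) _ O (conj Oop Ofg)).
move: nP nQ; rewrite !(@nbhsE (top_space tau)) => -[P' [P'op P'f] P'P] [Q' [Q'op Q'g] Q'Q].
have [i Bi iP] := Bbase P' f P'op P'f; have [j Bj jQ] := Bbase Q' g Q'op Q'g.
exists i, j; split=> // f' g' Bf' Bg'.
by apply: (PQ (f', g')); split; [exact/P'P/iP|exact/Q'Q/jQ].
Qed.

Lemma step_le_subproof (y : rat) :
  {homo (fun z => if z <= y then 0 else 1 : rat) : u v / u <= v}.
Proof.
by move=> u v uv; case: (leP v y) => vy; [rewrite (le_trans uv vy)|case: ifP].
Qed.

Lemma step_lt_subproof (y : rat) :
  {homo (fun z => if z < y then 0 else 1 : rat) : u v / u <= v}.
Proof.
by move=> u v uv; case: (ltP v y) => vy; [rewrite (le_lt_trans uv vy)|case: ifP].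
Qed.

Definition step_le (y : rat) : MQ := MQ_of (@step_le_subproof y).

Definition step_lt (y : rat) : MQ := MQ_of (@step_lt_subproof y).

(** The map g |-> p o g o c with c constant and p a two-valued step takes only
    two values, both constant maps. As points are closed, the two halves of
    the step at f x, with and without equality, are open conditions on g, and
    together they say that g x = f x. *)
Lemma eval_open (tau : Topological MQ) B f x : base_of tau B ->
  semigroup_topology MQ_comp tau ->
  (forall g, opens tau (~` [set g])) ->
  exists2 k, B k f & forall g, B k g -> g x = f x.
Proof.
move=> BB comp_cont T1.
have sandwich p c : MQ_comp (MQ_comp p f) (MQ_cst x) <> c ->
    exists2 k, B k f & forall g, B k g -> MQ_comp (MQ_comp p g) (MQ_cst x) <> c.
  move=> pc.
  have [i [j [Bi Bj ij]]] := comp_open BB comp_cont (T1 c) pc.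
  have [l [k [Bl Bk lk]]] := comp_open BB comp_cont (BB.1 i) Bi.
  by exists k => // g Bg; apply: ij => //; exact: lk.
have cst_neq (a b : rat) : a != b -> MQ_cst a <> MQ_cst b.
  by move=> /eqP ab /(congr1 (fun h : MQ => h 0)).
have [|k1 Bk1 k1P] := sandwich (step_le (f x)) (MQ_cst 1).
  rewrite (_ : MQ_comp _ _ = MQ_cst 0); first exact: cst_neq.
  apply: MQ_ext => z; rewrite -[LHS]/(if f x <= f x then 0 else 1 : rat).
  by rewrite lexx.
have [|k2 Bk2 k2P] := sandwich (step_lt (f x)) (MQ_cst 0).
  rewrite (_ : MQ_comp _ _ = MQ_cst 1); first exact: cst_neq.
  apply: MQ_ext => z; rewrite -[LHS]/(if f x < f x then 0 else 1 : rat).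
  by rewrite ltxx.
have [k Bk kP] := BB.2 _ _ (openI (BB.1 k1) (BB.1 k2) : opens tau (B k1 `&` B k2))
  (conj Bk1 Bk2).
exists k => // g /kP[Bg1 Bg2]; apply: le_anti; apply/andP; split.
  rewrite leNgt; apply/negP => fg; apply: (k1P g Bg1).
  apply: MQ_ext => z; rewrite -[LHS]/(if g x <= f x then 0 else 1 : rat).
  by rewrite leNgt fg.
rewrite leNgt; apply/negP => gf; apply: (k2P g Bg2).
apply: MQ_ext => z; rewrite -[LHS]/(if g x < f x then 0 else 1 : rat).
by rewrite gf.
Qed.

Lemma metrisable_T1 (R : realType) (tau : Topological MQ) :
  metrisable R (top_space tau) -> forall g, opens tau (~` [set g]).
Proof.
move=> [m mtau] g; rewrite /opens -mtau.
by apply: closed_openC; apply/accessible_closed_set1/hausdorff_accessible/metric_hausdorff.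
Qed.

Lemma metrisable_regular (R : realType) (tau : Topological MQ) O f :
  metrisable R (top_space tau) -> opens tau O -> O f ->
  exists N, [/\ opens tau N, N f & forall g,
    (forall W, opens tau W -> W g -> exists2 h, W h & N h) -> O g].
Proof.
move=> [m mtau]; rewrite /opens -mtau; pose T : metricType R := Metric.Pack m.
rewrite -/(@open T) => Oop Of.
have /nbhs_ballP[e /= e0 eO] := @open_nbhs_nbhs T f O (conj Oop Of).
have e20 : 0 < e / 2 by rewrite divr_gt0.
exists (interior (ball (f : T) (e / 2))); split.
- exact: open_interior.
- exact: nbhsx_ballx.
move=> g gN; apply: eO.
have [||h hg hf] := gN (interior (ball (g : T) (e / 2))).
- exact: open_interior.
- exact: nbhsx_ballx.
rewrite (splitr e); apply: ball_triangle (interior_subset hf) _.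
exact/ball_sym/(interior_subset hg).
Qed.

Lemma semigroup_base_of (R : realType) (tau : Topological MQ) B :
  sc_metrisable_baire_semigroup_topology R tau -> base_of tau B ->
  semigroup_base B.
Proof.
move=> [_ met baire comp_cont] BB; have [Bop Bbase] := BB.
split.
- by move=> k f g; exact: comp_open.
- by move=> f x; apply: (eval_open _ _ BB) => //; exact: metrisable_T1 met.
- move=> i j f Bi Bj.
  have [k Bk kP] := Bbase _ f
    (openI (Bop i) (Bop j) : opens tau (B i `&` B j)) (conj Bi Bj).
  by exists k.
- move=> U Uop Ud k f Bf.
  have [|||g [Bg gU]] := @baire U _ (B k); last by exists g => // n; exact: gU.
  + move=> n; split.
      rewrite openE => g /Uop[j Bj jU]; rewrite /interior nbhsE.
      by exists (B j) => //; split=> //; exact: Bop.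
    move=> O [g Og] Oop; have [j Bj jO] := Bbase O g Oop Og.
    by have [h Bh Uh] := Ud n j g Bj; exists h; split=> //; exact: jO.
  + by exists f.
  + exact: Bop.
- move=> k f Bf.
  have [N [Nop Nf NP]] := metrisable_regular met (Bop k) Bf.
  have [j Bj jN] := Bbase N f Nop Nf; exists j => // g gj; apply: NP => W Wop Wg.
  have [i Bi iW] := Bbase W g Wop Wg; have [h Bh Bjh] := gj i Bi.
  by exists h; [exact: iW|exact: jN].
Qed.

(* R is the real line in which metrics take their values. *)
Theorem mainTheorem2 (R : realType) :
  sc_metrisable_baire_semigroup_topology R pointwise_topology /\
  forall tau : Topological MQ,
    sc_metrisable_baire_semigroup_topology R tau ->
    opens tau = opens pointwise_topology.
Proof.
split.
  split; [exact: pointwise_second_countable|exact: pointwise_metrisable|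
          exact: pointwise_baire|exact: pointwise_semigroup].
move=> tau tauP; have [/second_countable_base[B Bbase] _ _ _] := tauP.
have BB := semigroup_base_of tauP Bbase.
apply/seteqP; split=> O.
  move=> Oop; apply/pointwise_open => f Of.
  have [k Bk kO] := Bbase.2 O f Oop Of.
  have [F FB] := base_sub_pointwise R BB Bk.
  by exists F => g /FB /kO.
move=> /pointwise_open Oop; rewrite /opens openE => f Of.
have [F FO] := Oop f Of; have [k Bk kF] := base_agree f F BB.
rewrite /interior nbhsE; exists (B k); first by split=> //; exact: Bbase.1.
by move=> g /kF; exact: FO.
Qed.
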